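(* Let $0<\alpha<1$, $u\in L^1(\mathbb{R})$ and $v\in L^1_{loc}(\mathbb{R})$. For each choice of sign $\pm$: ${}^{\pm}\mathcal{D}^{\alpha}u$ exists in $L^1_{loc}(\mathbb{R})$ and equals $v$ if and only if there exists a sequence $\{u_j\}_{j=1}^\infty\subset C_0^\infty(\mathbb{R})$ such that $u_j\to u$ in $L^1(\mathbb{R})$ and ${}^{\pm}\mathcal{D}^{\alpha}u_j\to v$ in $L^1_{loc}(\mathbb{R})$.
   Context: Fractional integrals on $\mathbb{R}$, for $\sigma>0$: ${}^{-}I^{\sigma}f(x)=\frac{1}{\Gamma(\sigma)}\int_{-\infty}^x\frac{f(y)}{(x-y)^{1-\sigma}}\,dy$ and ${}^{+}I^{\sigma}f(x)=\frac{1}{\Gamma(\sigma)}\int_x^\infty\frac{f(y)}{(y-x)^{1-\sigma}}\,dy$. For $0<\alpha<1$: ${}^{-}D^{\alpha}\varphi=\frac{d}{dx}\,{}^{-}I^{1-\alpha}\varphi$ and ${}^{+}D^{\alpha}\varphi=-\frac{d}{dx}\,{}^{+}I^{1-\alpha}\varphi$. Weak fractional derivatives ($0<\alpha<1$): for $u\in L^1(\mathbb{R})$, a function $v\in L^1_{loc}(\mathbb{R})$ is the left (resp. right) weak fractional derivative of $u$, written $v={}^{-}\mathcal{D}^{\alpha}u$ (resp. $v={}^{+}\mathcal{D}^{\alpha}u$), if $\int_{\mathbb{R}} v\varphi\,dx=\int_{\mathbb{R}} u\,{}^{+}D^{\alpha}\varphi\,dx$ (resp. $\int_{\mathbb{R}}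 v\varphi\,dx=\int_{\mathbb{R}} u\,{}^{-}D^{\alpha}\varphi\,dx$) for all $\varphi\in C_0^\infty(\mathbb{R})$. *)

(* Defs.v *)
From mathcomp Require Import all_boot all_order all_algebra.
From mathcomp Require Import all_classical all_reals all_analysis.

Set Implicit Arguments.
Unset Strict Implicit.
Unset Printing Implicit Defensive.

Import Order.TTheory GRing.Theory Num.Theory.
Import numFieldNormedType.Exports.

Local Open Scope classical_set_scope.
Local Open Scope ring_scope.

Definition Gamma (R : realType) (s : R) : R :=
  \int[lebesgue_measure]_(t in `]0, +oo[) (t `^ (s - 1) * expR (- t)).

(* [Left] is the sign "-" (integration over the past), [Right] the sign "+". *)
Variant side := Left | Right.

Definition opposite (d : side) : side :=
  match d with Left => Right | Right => Left end.

Definition frac_integral (R : realType) (d : side) (s : R) (f : R -> R)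
    (x : R) : R :=
  match d with
  | Left => (Gamma s)^-1 *
      \int[lebesgue_measure]_(y in `]-oo, x[) (f y / (x - y) `^ (1 - s))
  | Right => (Gamma s)^-1 *
      \int[lebesgue_measure]_(y in `]x, +oo[) (f y / (y - x) `^ (1 - s))
  end.

Definition frac_derivative (R : realType) (d : side) (a : R) (f : R -> R)
    (x : R) : R :=
  match d with
  | Left => (frac_integral Left (1 - a) f)^`()%classic x
  | Right => - (frac_integral Right (1 - a) f)^`()%classic x
  end.

Definition smooth (R : realType) (f : R -> R) : Prop :=
  forall (n : nat) (x : R), derivable f^`(n)%classic x 1.

(* C_0^oo: smooth with compact support (not merely vanishing at infinity). *)
Definition test_function (R : realType) (f : R -> R) : Prop :=
  smooth f /\ compact (closure [set x | f x != 0]).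

Definition L1 (R : realType) (f : R -> R) : Prop :=
  (@lebesgue_measure R).-integrable setT (EFin \o f).

Definition L1loc (R : realType) (f : R -> R) : Prop :=
  locally_integrable setT f.

(* [v] is (a representative of) the weak derivative of [u] on side [d]; the
   test function carries the classical derivative of the opposite side. *)
Definition is_weak_frac_derivative (R : realType) (d : side) (a : R)
    (u v : R -> R) : Prop :=
  L1loc v /\
  forall phi : R -> R, test_function phi ->
    \int[lebesgue_measure]_x (v x * phi x) =
    \int[lebesgue_measure]_x (u x * frac_derivative (opposite d) a phi x).

Definition cvg_L1 (R : realType) (f_ : nat -> R -> R) (f : R -> R) : Prop :=
  (fun j => \int[lebesgue_measure]_x `|f_ j x - f x|%:E)%E @ \oo --> 0%E.

Definition cvg_L1loc (R : realType) (f_ : nat -> R -> R) (f : R -> R) : Prop :=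
  forall K : set R, compact K ->
    (fun j => \int[lebesgue_measure]_(x in K) `|f_ j x - f x|%:E)%E
      @ \oo --> 0%E.

(* Main.v *)
(** Every operation is a convolution [f * g].  On test functions the fractional
    derivative is [D phi = c (k * phi')] with the one-sided kernel [k] equal to
    [|t|^(-a)] on a half-line, and [k] is locally integrable.  Fubini gives
    [f * (g * h) = g * (f * h)], which yields integration by parts for test functions
    and [D (f * phi) = f * D phi], while testing the weak derivative against
    [eta (x - .)] gives [u * D eta = v * eta] for [u] in [L^1] with weak derivative [v].

    If [v] is the weak derivative of [u], put [w = (u 1_[-r,r]) * eta] with [eta] a
    mollifier of scale [eps].  Then
      [D w = v * eta - (u 1_{|y| > r}) * D eta],
    where [v * eta] is close to [v] in [L^1_loc] once [eps] is small; as [D eta] tends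
    to [0] at infinity, for this fixed [eps] the last term is uniformly small on compact
    sets once [r] is large.  The converse is a passage to the limit in the defining
    identity, using that [D phi] is bounded. *)

Require Import Defs.
From HB Require Import structures.
From mathcomp Require Import all_boot all_order all_algebra.
From mathcomp Require Import all_classical all_reals all_analysis.
From mathcomp Require Import measurable_realfun.
From mathcomp Require Import lra ring.

Import Order.TTheory GRing.Theory Num.Theory.
Import numFieldNormedType.Exports.

Local Open Scope classical_set_scope.
Local Open Scope ring_scope.

(** * Reflection invariance of Lebesgue measure *)

Section Reflection.
Set Implicit Arguments.
Unset Strict Implicit.
Variable R : realType.
Notation mu := (@lebesgue_measure R).
Implicit Types (f g : R -> R) (x y c B M : R).

(** The kernel lives on a whole half-line, so [D eta] cannot be expected to have compact support.
    Mollifying [u] alone gives the right derivative [v * eta] but no test function; truncation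
    repairs this at the price of a tail term that only the decay of [D eta] controls. The radius
    where [D eta] becomes small depends on [eta], so the scale has to be fixed before [r]; yet [w]
    must be close to [u] in [L^1] for the [r] chosen afterwards. An auxiliary radius [N <= r] breaks
    the circle: the scale is adapted to [u 1_[-N,N]] only, and the rest [u 1_[-r,r] - u 1_[-N,N]],
    small in [L^1] by the choice of [N], does not grow under convolution with [eta]. The kernel is
    integrable near [0] because [a < 1] and decays because [a > 0], but it is not integrable at
    infinity. Each exchange of integrals therefore draws its integrability from the compact supports
    of the other factors. Reflections [x |-> c - x] are the basic symmetry: they turn a pairing into
    a value of a convolution and exchange the two sides. *)

Lemma lebesgue_measure_reflect c (A : set R) : measurable A ->
  pushforward mu ((fun x => c - x) : _ -> measurableTypeR R) A = mu A.
Proof.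
have mr : measurable_fun setT ((fun x => c - x) : measurableTypeR R -> measurableTypeR R).
  by apply: measurable_funB => //.
pose m := isMeasurableFun.Build _ _ _ _ _ mr.
pose p : {mfun measurableTypeR R >-> measurableTypeR R} := HB.pack (fun x => c - x) m.
move=> mA; apply/esym/(@lebesgue_measure_unique _ (pushforward mu p)) => //= _ [[a b]] _ <-.
rewrite /pushforward/=.
(* Half-open intervals determine the measure; reflection moves the open endpoint to the other side
   and keeps the length. *)
have -> : (fun x => c - x) @^-1` `]a, b] = `[c - b, c - a[%classic.
  by apply/seteqP; split => x /=; rewrite !in_itv/= => /andP[h1 h2]; apply/andP; split; lra.
rewrite !lebesgue_measure_itv/= !lte_fin.
have -> : (c - b < c - a) = (a < b) by apply/idP/idP; lra.
by case: ifP => // _; rewrite -!EFinB; congr EFin; lra.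
Qed.

Lemma ge0_integral_reflect c (f : R -> \bar R) : measurable_fun setT f ->
  (forall x, 0 <= f x)%E ->
  (\int[mu]_x f (c - x)%R = \int[mu]_x f x)%E.
Proof.
move=> mf f0.
pose r : measurableTypeR R -> measurableTypeR R := fun x => c - x.
have mr : measurable_fun setT r by exact: measurable_funB.
have := @ge0_integral_pushforward _ _ _ _ _ r mr mu setT f measurableT mf.
rewrite preimage_setT /= => <-; last by move=> x _; exact: f0.
by apply: eq_measure_integral => A mA _; exact: lebesgue_measure_reflect.
Qed.

Lemma integral_reflect c (f : R -> \bar R) : measurable_fun setT f ->
  (\int[mu]_x f (c - x)%R = \int[mu]_x f x)%E.
Proof.
move=> mf; rewrite integralE [RHS]integralE.
under eq_integral do rewrite (funepos_comp f (fun x => c - x)%R)/=.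
under [X in (_ - X)%E]eq_integral do rewrite (funeneg_comp f (fun x => c - x)%R)/=.
rewrite (@ge0_integral_reflect c f^\+)%E//; last exact: measurable_funepos.
by rewrite (@ge0_integral_reflect c f^\-)%E//; exact: measurable_funeneg.
Qed.

Lemma Rintegral_reflect c f : measurable_fun setT f ->
  \int[mu]_x f (c - x)%R = \int[mu]_x f x.
Proof.
by move=> mf; rewrite /Rintegral (@integral_reflect c (EFin \o f))//; exact/measurable_EFinP.
Qed.

(** A translation is the composite of two reflections. *)
Lemma ge0_integral_shift c (f : R -> \bar R) : measurable_fun setT f ->
  (forall x, 0 <= f x)%E ->
  (\int[mu]_x f (x - c)%R = \int[mu]_x f x)%E.
Proof.
move=> mf f0.
transitivity (\int[mu]_x (f (- x - c)%R))%E.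
  rewrite -[RHS](@ge0_integral_reflect 0)//=; last first.
    by apply: measurableT_comp => //; apply: measurable_funB.
  by apply: eq_integral => x _; rewrite sub0r opprK.
rewrite -(@ge0_integral_reflect (- c) f)//.
by apply: eq_integral => x _; rewrite addrC.
Qed.

End Reflection.

(** * Locally integrable functions *)

Section LocallyIntegrable.
Set Implicit Arguments.
Unset Strict Implicit.
Variable R : realType.
Notation mu := (@lebesgue_measure R).
Implicit Types (f g : R -> R) (x y c B M : R).

(** The strict inequality makes the region [M < |x|] open, so [f] vanishes near each of its points
    and so does the derivative. Radii add under convolution. *)
Definition supported M f := forall x, M < `|x| -> f x = 0.
Definition bounded_by B f := forall x, `|f x| <= B.

Lemma compact_sub_itv (K : set R) : compact K ->
  exists M, 0 < M /\ K `<=` `[- M, M].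
Proof.
move=> /compact_bounded [M [_ hM]].
exists (`|M| + 1); split; first by rewrite ltr_pwDr.
move=> x Kx /=; rewrite in_itv/= -ler_norml.
by apply: hM Kx; rewrite ltr_pwDr// ler_norm.
Qed.

Lemma L1locP f : L1loc f <->
  measurable_fun setT f /\ forall M, mu.-integrable `[- M, M] (EFin \o f).
Proof.
split=> [[mf _ intf]|[mf intf]].
  split=> // M; apply/integrableP; split.
    by apply/measurable_EFinP; exact: measurable_funTS.
  by apply: intf => //; exact: segment_compact.
split => //; first exact: openT.
move=> K _ cK; have [M [_ KM]] := compact_sub_itv cK.
have /integrableP[_] := intf M; apply: le_lt_trans.
apply: ge0_subset_integral => //=; first exact: compact_measurable.
by apply/measurable_EFinP/measurableT_comp => //; exact: measurable_funTS.
Qed.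

Lemma L1loc_measurable f : L1loc f -> measurable_fun setT f.
Proof. by case. Qed.

Lemma L1_L1loc f : L1 f -> L1loc f.
Proof. by move=> /open_integrable_locally; apply; exact: openT. Qed.

Lemma L1loc_norm f : L1loc f -> L1loc (fun y => `|f y|).
Proof.
move=> [mf ? lf]; split=> //; first exact: measurableT_comp.
by move=> K KT cK; under eq_integral do rewrite normr_id; exact: lf.
Qed.

Lemma continuous_L1loc f : continuous f -> L1loc f.
Proof.
move=> cf; apply/L1locP; split; first exact: continuous_measurable_fun.
by move=> M; apply: continuous_compact_integrable;
  [exact: segment_compact|exact: continuous_subspaceT].
Qed.

Lemma le_normM_patch f g B M : bounded_by B g -> supported M g ->
  forall x, (`|(f x * g x)%:E| <= `|((cst B \* f) \_ `[- M, M]) x|%:E)%E.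
Proof.
move=> bg sg x; rewrite lee_fin patchE; case: ifPn => /= [_|].
  by rewrite mulrC !normrM ler_wpM2r// (le_trans (bg x))// ler_norm.
rewrite notin_setE/= in_itv/= -ler_norml => /negP; rewrite -ltNge => /sg ->.
by rewrite mulr0 !normr0.
Qed.

(** The usual source of integrability below: one factor may be singular, the other is bounded with
    compact support. Linearity of the real integral needs such a check, since [fine] sends an
    infinite integral to [0]. *)
Lemma integrableM_supported f g B M : L1loc f -> measurable_fun setT g ->
  bounded_by B g -> supported M g ->
  mu.-integrable setT (fun y => (f y * g y)%:E).
Proof.
move=> /L1locP[mf lf] mg bg sg.
have h : mu.-integrable setT (EFin \o ((cst B \* f) \_ `[- M, M])).
  rewrite -restrict_EFin; apply/(integrable_mkcond _ _).1 => //.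
  have h : mu.-integrable `[- M, M] (fun x => (B%:E * (EFin \o f) x)%E).
    exact: integrableZl.
  exact: eq_integrable h.
apply: le_integrable h => //.
  by apply/measurable_EFinP/measurable_funM.
by move=> x _ /=; exact: le_normM_patch.
Qed.

Lemma ge0_integral_supported f M : supported M f ->
  (\int[mu]_x `|f x|%:E = \int[mu]_(x in `[(- M)%R, M]) `|f x|%:E)%E.
Proof.
move=> sf; rewrite [RHS]integral_mkcond; apply: eq_integral => x _.
rewrite patchE; case: ifPn => //.
rewrite notin_setE/= in_itv/= -ler_norml => /negP; rewrite -ltNge => /sf ->.
by rewrite normr0.
Qed.

Lemma le_integralM_supported f g B (A : set R) : measurable A ->
  measurable_fun setT f -> measurable_fun setT g -> 0 <= B -> bounded_by B g ->
  (forall x, ~ A x -> g x = 0) ->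
  (\int[mu]_x `|(f x * g x)%R|%:E <= B%:E * \int[mu]_(x in A) `|f x|%:E)%E.
Proof.
move=> mA mf mg B0 bg sg.
rewrite -ge0_integralZl//=; last first.
  by apply/measurable_EFinP/measurableT_comp => //; exact: measurable_funTS.
rewrite [leRHS]integral_mkcond; apply: ge0_le_integral => //=.
- by apply/measurable_EFinP/measurableT_comp => //; exact: measurable_funM.
- apply/(measurable_restrictT _ _).1 => //.
  apply/measurable_EFinP/measurable_funM => //.
  by apply/measurableT_comp => //; exact: measurable_funTS.
move=> x _; rewrite patchE; case: ifPn => [_|].
  by rewrite -EFinM lee_fin normrM mulrC ler_wpM2r.
by rewrite notin_setE => /sg ->; rewrite mulr0 normr0.
Qed.

Lemma Rintegral_le_abs f : measurable_fun setT f ->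
  (`|\int[mu]_x f x|%:E <= \int[mu]_x `|f x|%:E)%E.
Proof.
move=> mf; have mf' : measurable_fun setT (EFin \o f) by exact/measurable_EFinP.
have h := @le_abse_integral _ _ _ mu _ _ measurableT mf'.
apply: le_trans h; rewrite /Rintegral.
have [/fineK <-//|] := boolP (\int[mu]_x (f x)%:E \is a fin_num)%E.
by rewrite fin_numEn => /orP[|] /eqP ->; rewrite /= ?normr0 ?leey.
Qed.

End LocallyIntegrable.

(** * Convolution *)

Section Convolution.
Set Implicit Arguments.
Unset Strict Implicit.
Variable R : realType.
Notation mu := (@lebesgue_measure R).
Implicit Types (f g h phi : R -> R) (x y c B M : R).

Definition conv f g x := \int[mu]_y (f y * g (x - y)).

Lemma supported_reflect x M g : supported M g ->
  supported (`|x| + M) (fun y => g (x - y)).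
Proof.
move=> sg y h; apply: sg.
have : `|y| <= `|x| + `|x - y|.
  by rewrite -{1}[y](subKr x) (le_trans (ler_normB _ _)).
lra.
Qed.

Lemma supported_derive1 M f : supported M f -> supported M f^`()%classic.
Proof.
move=> sf x h; rewrite -(derive1_cst (0 : R) x) !derive1E.
apply: near_eq_derive.
have : `|y| @[y --> x] --> `|x| by exact: norm_continuous.
move/cvgr_gt => /(_ _ h); apply: filterS => y /= hy.
exact: sf.
Qed.

Lemma continuous_supported_bounded M f : continuous f -> supported M f ->
  exists B, 0 < B /\ bounded_by B f.
Proof.
move=> cf sf.
have cK : compact [set f x | x in `[- M, M]].
  by apply: continuous_compact; [exact: continuous_subspaceT|exact: segment_compact].
have [B [B0 hB]] := compact_sub_itv cK.
exists B; split=> // x; have [xM|/sf ->] := leP `|x| M; last by rewrite normr0 ltW.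
have := hB (f x); rewrite /= in_itv/= -ler_norml; apply.
by exists x => //=; rewrite in_itv/= -ler_norml.
Qed.

Lemma measurable_reflect f c : measurable_fun setT f ->
  measurable_fun setT (fun y => f (c - y)).
Proof. by move=> mf; apply: measurableT_comp => //; exact: measurable_funB. Qed.

Lemma derivable_continuous f : (forall x, derivable f x 1) -> continuous f.
Proof. by move=> df x; apply/differentiable_continuous/derivable1_diffP. Qed.

Lemma convC f g : measurable_fun setT f -> measurable_fun setT g ->
  conv f g = conv g f.
Proof.
move=> mf mg; apply/funext => x; rewrite /conv.
rewrite -(@Rintegral_reflect _ x); last first.
  by apply: measurable_funM => //; exact: measurable_reflect.
by apply: eq_Rintegral => y _; rewrite mulrC opprB addrC subrK.
Qed.

Lemma is_derive_comp_subr f y x : derivable f (x - y) 1 ->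
  is_derive x 1 (fun z => f (z - y)) (f^`()%classic (x - y)).
Proof.
move=> df; have d1 : is_derive x 1 (fun z => z - y) (1 - 0) by exact: is_deriveB.
have d2 : is_derive (x - y) 1 f (f^`()%classic (x - y)).
  by rewrite derive1E; exact: DeriveDef.
have := @is_derive1_comp R f (fun z => z - y) x _ _ d2 d1.
by rewrite subr0 mulr1.
Qed.

Lemma is_derive_comp_subl f c x : derivable f (c - x) 1 ->
  is_derive x 1 (fun z => f (c - z)) (- f^`()%classic (c - x)).
Proof.
move=> df; have d1 : is_derive x 1 (fun z => c - z) (0 - 1) by exact: is_deriveB.
have d2 : is_derive (c - x) 1 f (f^`()%classic (c - x)).
  by rewrite derive1E; exact: DeriveDef.
have := @is_derive1_comp R f (fun z => c - z) x _ _ d2 d1.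
by rewrite sub0r mulrN1.
Qed.

Lemma is_derive1E f x d : is_derive x 1 f d -> f^`()%classic x = d.
Proof. by move=> h; rewrite derive1E; exact: derive_val. Qed.

Lemma derive_conv f phi M : L1loc f -> (forall x, derivable phi x 1) ->
  continuous phi^`()%classic -> supported M phi ->
  forall x, derivable (conv f phi) x 1 /\
    (conv f phi)^`()%classic x = conv f phi^`()%classic x.
Proof.
move=> lf dphi cphi' sphi x.
have cphi := derivable_continuous dphi.
have mphi := continuous_measurable_fun cphi.
have mphi' := continuous_measurable_fun cphi'.
have mf := L1loc_measurable lf.
have [B [B0 bphi]] := continuous_supported_bounded cphi sphi.
have sphi' := supported_derive1 sphi.
have [B' [B'0 bphi']] := continuous_supported_bounded cphi' sphi'.
have dE y z : (fun x' => f y * phi (x' - y))^`()%classic z =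
    f y * phi^`()%classic (z - y).
  have d := is_derive_comp_subr (dphi (z - y)).
  by rewrite derive1Ml ?(is_derive1E d).
have intf z : z \in `]x - 1, x + 1[ ->
    mu.-integrable setT (EFin \o (fun y => f y * phi (z - y))).
  move=> _; apply: (@integrableM_supported _ _ _ B (`|z| + M)) => //.
  - exact: measurable_reflect.
  - exact: supported_reflect.
(* For [z] within [1] of [x] and [|y| > |x| + 1 + M] one has [|z - y| > M], so one indicator
   dominates the derivatives on the whole window. *)
pose G y := `|f y| * (B' * \1_`[- (`|x| + 1 + M), `|x| + 1 + M] y).
have Ix : x \in `]x - 1, x + 1[ by rewrite in_itv/=; apply/andP; split; lra.
have dphi1 z y : z \in `]x - 1, x + 1[ -> setT y ->
    derivable (fun x' => f y * phi (x' - y)) z 1.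
  move=> _ _; apply: derivableM => //.
  by have [] := is_derive_comp_subr (dphi (z - y)).
have G0 y : 0 <= G y.
  by rewrite /G mulr_ge0// mulr_ge0// ltW.
have intG : mu.-integrable setT (EFin \o G).
  apply: (@integrableM_supported _ (fun y => `|f y|) _ B' (`|x| + 1 + M)).
  - exact: L1loc_norm.
  - by apply: measurable_funM.
  - move=> y; rewrite indicE; case: (_ \in _); last by rewrite mulr0 normr0 ltW.
    by rewrite mulr1 ger0_norm// ltW.
  - move=> y hy; rewrite indicE memNset ?mulr0//= in_itv/= -ler_norml.
    by apply/negP; rewrite -ltNge.
have ubG z y : z \in `]x - 1, x + 1[ -> setT y ->
   `|(fun x' => f y * phi (x' - y))^`()%classic z| <= G y.
  move=> zI _; rewrite dE normrM ler_wpM2l//.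
  have [h|h] := lerP (`|y| : R) (`|x| + 1 + M).
    by rewrite indicE mem_set/= ?mulr1// in_itv/= -ler_norml.
  have h1 : `|z - x| < 1.
    by rewrite ltr_norml; move: zI; rewrite in_itv/= => /andP[? ?]; apply/andP; split; lra.
  have h2 : `|y : R| <= `|x| + (`|z - x| + `|z - y|).
    rewrite -{1}[y](subKr z) (le_trans (ler_normB _ _))// addrA lerD2r.
    by rewrite -{1}[z](subrK x) addrC ler_normD.
  have h3 := lt_le_trans h h2.
  have h4 : M < `|z - y| by lra.
  by rewrite (sphi' _ h4) normr0 mulr_ge0// ltW.
split.
  exact: (@derivable_under_integral R _ _ mu (fun x y => f y * phi (x - y)) setT measurableT
    x (x - 1) (x + 1) Ix intf dphi1 G G0 intG ubG).
rewrite /conv.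
rewrite (@differentiation_under_integral R _ _ mu (fun x y => f y * phi (x - y)) setT measurableT
    x (x - 1) (x + 1) Ix intf dphi1 G G0 intG ubG).
by apply: eq_Rintegral => y _; rewrite /partial1of2 dE.
Qed.

End Convolution.

(** * Fubini and Tonelli for convolutions *)

Section Fubini.
Set Implicit Arguments.
Unset Strict Implicit.
Variable R : realType.
Notation mu := (@lebesgue_measure R).
Implicit Types (f g h phi eta : R -> R) (x y c B M : R).

Lemma EFin_Rintegral f : mu.-integrable setT (EFin \o f) ->
  ((\int[mu]_x f x)%:E = \int[mu]_x (f x)%:E)%E.
Proof. by move=> intf; rewrite fineK//; exact: integrable_fin_num. Qed.

(** Both sides integrate [f y * g z * h (x - y - z)]. Here [f] may lack compact support; the
    supports of [g] and [h] confine [y] to [|y| <= |x| + M + M']. *)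
Lemma conv_conv f g h M M' B x : L1loc f -> L1loc g -> supported M g ->
  measurable_fun setT h -> bounded_by B h -> supported M' h ->
  conv f (conv g h) x = conv g (conv f h) x.
Proof.
move=> lf lg sg mh bh sh.
have mf := L1loc_measurable lf; have mg := L1loc_measurable lg.
have ih k z : L1loc k -> mu.-integrable setT (EFin \o (fun y => k y * h (z - y))).
  move=> lk; apply: (@integrableM_supported _ _ _ B (`|z| + M')) => //.
    exact: measurable_reflect.
  exact: supported_reflect.
pose F (p : measurableTypeR R * measurableTypeR R) := (f p.1 * (g p.2 * h (x - p.1 - p.2)))%:E.
have mF : measurable_fun setT F.
  apply/measurable_EFinP/measurable_funM; first exact: measurableT_comp.
  apply: measurable_funM; first exact: measurableT_comp.
  apply: measurableT_comp => //; apply: measurable_funB => //.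
  exact: measurable_funB.
have B0 : 0 <= B by apply: le_trans (bh 0).
pose K := `|x| + (M + M').
have intF : (mu \x mu)%E.-integrable setT F.
  apply/integrable12ltyP => //.
  pose C := (\int[mu]_z `|g z|%:E)%E.
  have Coo : (C < +oo)%E.
    rewrite /C (ge0_integral_supported sg).
    by have /L1locP[_ /(_ M)/integrableP[]] := lg.
  have C0 : (0 <= C)%E by apply: integral_ge0.
  pose k y := B * \1_`[- K, K] y.
  have mk : measurable_fun setT k by apply: measurable_funM.
  have bk y : `|k y| <= B.
    rewrite /k indicE; case: (_ \in _); last by rewrite mulr0 normr0.
    by rewrite mulr1 ger0_norm.
  have sk : supported K k.
    move=> y hy; rewrite /k indicE memNset ?mulr0//= in_itv/= -ler_norml.
    by apply/negP; rewrite -ltNge.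
  have ifk : mu.-integrable setT (fun y => (f y * k y)%:E).
    exact: (@integrableM_supported _ _ _ B K).
  (* Replacing [h] by its bound on the interval of radius [K] separates the variables: the inner
     integral is at most [|f y * k y|] times the norm [C] of [g]. *)
  apply: (@le_lt_trans _ _ (\int[mu]_y (C * `|(f y * k y)%:E|))%E).
    apply: ge0_le_integral => //=.
    - by move=> y _; exact: integral_ge0.
    - apply: (@measurable_fun_fubini_tonelli_F _ _ _ _ _ mu (abse \o F)) => //.
      + by apply: measurableT_comp.
      + by move=> p; exact: abse_ge0.
    - apply: measurable_funeM; apply/measurable_EFinP/measurableT_comp => //.
      exact: measurable_funM.
    move=> y _; rewrite muleC -ge0_integralZl//; last first.
      by apply/measurable_EFinP/measurableT_comp.
    apply: ge0_le_integral => //=.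
    - by apply/measurable_EFinP/measurableT_comp => //; apply: measurable_funM => //;
       apply: measurable_funM => //; exact: measurable_reflect.
    - by apply/measurable_EFinP/measurable_funM => //; apply/measurableT_comp.
    move=> z _; rewrite -EFinM lee_fin !normrM -mulrA ler_wpM2l//.
    rewrite mulrC; have [yK|yK] := lerP (`|y| : R) K.
      rewrite indicE mem_set/= ?in_itv/= -?ler_norml// normr1 mulr1 ler_wpM2r//.
      by rewrite (ger0_norm B0).
    have [zM|zM] := lerP (`|z| : R) M; last by rewrite (sg _ zM) normr0 !mulr0.
    rewrite (sh (x - y - z)) ?normr0 ?mul0r ?mulr_ge0//.
    have h1 : `|y : R| <= `|x| + `|x - y|.
      by rewrite -{1}[y](subKr x) (le_trans (ler_normB _ _)).
    have h2 : `|x - y| <= `|z| + `|x - y - z|.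
      by rewrite -{1}[x - y](subrK z) addrC ler_normD.
    have := lt_le_trans yK h1; rewrite /K; lra.
  rewrite ge0_integralZl//; last first.
    by apply/measurable_EFinP/measurableT_comp => //; exact: measurable_funM.
  by apply: lte_mul_pinfty => //; [rewrite ge0_fin_numE|case/integrableP: ifk].
have H := @Fubini _ _ _ _ _ mu mu F intF.
rewrite /conv.
transitivity (fine (\int[mu]_y \int[mu]_z F (y, z))%E).
  congr fine; apply: eq_integral => y _.
  rewrite -RintegralZl//; last exact: ih.
  rewrite EFin_Rintegral//=.
  by have := integrableZl (measurableT) (f y) (ih g (x - y) lg); apply: eq_integrable.
rewrite H; congr fine; apply: eq_integral => z _.
rewrite -RintegralZl//; last exact: ih.
rewrite EFin_Rintegral//=.
  by apply: eq_integral => y _; rewrite /F/= mulrCA (addrAC x).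
have := integrableZl (measurableT) (g z) (ih f (x - z) lf).
by apply: eq_integrable.
Qed.

(** Young's inequality for a density: by Tonelli, [|f y| * eta (x - y)] may be integrated in [x]
    first, and translates of [eta] have mass one. *)
Lemma le_L1_conv f eta : measurable_fun setT f -> measurable_fun setT eta ->
  (forall x, 0 <= eta x) -> (\int[mu]_x (eta x)%:E = 1)%E ->
  measurable_fun setT (conv f eta) ->
  (\int[mu]_x `|conv f eta x|%:E <= \int[mu]_x `|f x|%:E)%E.
Proof.
move=> mf meta eta0 eta1 mc.
pose F (p : measurableTypeR R * measurableTypeR R) := (`|f p.2| * eta (p.1 - p.2))%:E.
have mF : measurable_fun setT F.
  apply/measurable_EFinP/measurable_funM; first by do 2 apply: measurableT_comp => //.
  by apply: measurableT_comp => //; apply: measurable_funB.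
have F0 p : (0 <= F p)%E by rewrite lee_fin mulr_ge0.
apply: (@le_trans _ _ (\int[mu]_x \int[mu]_y F (x, y))%E).
  apply: ge0_le_integral => //=.
  - by apply/measurable_EFinP/measurableT_comp.
  - exact: (@measurable_fun_fubini_tonelli_F _ _ _ _ _ mu F).
  move=> x _.
  have mm : measurable_fun setT (fun y => f y * eta (x - y)).
    by apply: measurable_funM => //; exact: measurable_reflect.
  apply: le_trans (Rintegral_le_abs mm) _.
  rewrite le_eqVlt; apply/orP; left; apply/eqP; apply: eq_integral => y _.
  by rewrite normrM (ger0_norm (eta0 _)).
rewrite (@fubini_tonelli _ _ _ _ _ mu mu F)//.
rewrite le_eqVlt; apply/orP; left; apply/eqP; apply: eq_integral => y _.
rewrite /F/=; under eq_integral do rewrite EFinM.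
rewrite ge0_integralZl//; last 2 first.
  - by apply/measurable_EFinP; apply: measurableT_comp => //; apply: measurable_funB.
  - by move=> x _; rewrite lee_fin.
rewrite (@ge0_integral_shift _ y (fun x => (eta x)%:E)) ?eta1 ?mule1//.
exact/measurable_EFinP.
Qed.

End Fubini.

(** * Mollification in the local [L^1] norm *)

Section Mollification.
Set Implicit Arguments.
Unset Strict Implicit.
Variable R : realType.
Notation mu := (@lebesgue_measure R).
Implicit Types (f g h phi eta : R -> R) (x y c B M e d : R).

(** The regularity recorded is the one that [derive_conv] asks for; smoothness is a separate
    conjunct of [mollifier_exists]. *)
Definition mollifier e eta :=
  [/\ (forall x, derivable eta x 1) /\ continuous eta^`()%classic,
      forall x, 0 <= eta x, supported e eta & (\int[mu]_x (eta x)%:E = 1)%E].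

(** Heine's argument by near coverings. Only [x] is confined to the compact interval; [x - s] may
    leave it, so uniform continuity of the restriction would not suffice. *)
Lemma uniformly_continuous_itv g M e : continuous g -> 0 < e ->
  exists d, 0 < d /\
    forall x s, `|x| <= M -> `|s| <= d -> `|g (x - s) - g x| <= e.
Proof.
move=> cg e0.
have cK : compact `[- M, M] by exact: segment_compact.
have /compact_near_coveringP H := cK.
have : \forall d \near 0^'+, `[- M, M] `<=`
    (fun x => forall s, `|s| <= d -> `|g (x - s) - g x| <= e).
  apply: H => x' _; have [x ->] : exists x : R, x' = x by exists x'.
  have e2 : 0 < e / 2 by rewrite divr_gt0.
  have /cvgrPdist_le/(_ _ e2)/nbhs_ballP[r /= r0 hr] := cg x.
  (* With half the radius of continuity at [x], both [z] and [z - s] stay within [r] of [x]. *)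
  have r2 : 0 < r / 2 by rewrite divr_gt0.
  exists (ball x (r / 2), [set d | d < r / 2]).
    split => /=; first exact: nbhsx_ballx.
    exact: nbhs_right_lt.
  move=> [z d] [/= xz dr] s sd.
  have xz' : `|x - z : R| < r / 2 by move: xz; rewrite -ball_normE.
  have h1 : `|x - z : R| < r by lra.
  have h2 : `|x - (z - s) : R| < r.
    have := ler_normD (x - z : R) s.
    have -> : x - z + s = x - (z - s) by ring.
    lra.
  have h3 : `|g x - g (z - s)| <= e / 2 by apply: hr; rewrite -ball_normE.
  have h4 : `|g x - g z| <= e / 2 by apply: hr; rewrite -ball_normE.
  have := ler_distD (g x) (g (z - s)) (g z); rewrite (distrC _ (g x)); lra.
move=> /(filterI (nbhs_right_gt 0)) /filter_ex [d [/= d0 hd]].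
exists d; split=> // x s xM sd.
by apply: (hd x) => //=; rewrite in_itv/= -ler_norml.
Qed.

(** For a continuous [g] close to [f] in [L^1], [f * eta - f] splits into [(f - g) * eta],
    [g * eta - g] and [-(f - g)]. The threshold [e0] is found before [eta] is given. *)
Lemma cvg_mollification f M d : L1loc f -> 0 < M -> 0 < d ->
  exists e0 : R, 0 < e0 /\ forall e eta, e <= e0 -> mollifier e eta ->
   (\int[mu]_(x in `[(- M)%R, M]) `|(conv f eta x - f x)%R|%:E <= d%:E)%E.
Proof.
move=> lf M0 d0.
have /L1locP[mf intf] := lf.
(* The margin [1] matches [e <= 1]: on [[-M, M]] the convolution only sees values in [[-N, N]]. *)
pose N := M + 1; pose E := `[- N, N]%classic : set R.
have mE : measurable E by exact: measurable_itv.
have Eoo : (mu E < +oo)%E.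
  by rewrite /E lebesgue_measure_itv/=; case: ifP => // _; rewrite -EFinB ltry.
have [g_ [cg_ _ /fine_cvgP[fin cvg]]] := approximation_continuous_integrable mE Eoo (intf N).
have d4 : 0 < d / 4 by rewrite divr_gt0.
have [g [cg hg]] : exists g, continuous g /\
    (\int[mu]_(x in E) `|(f x - g x)%R|%:E <= (d / 4)%:E)%E.
  have /cvgr0_norm_le/(_ _ d4) := cvg.
  move=> /(filterI fin) /filter_ex[n /= [finn hn]].
  exists (g_ n); split=> //.
  rewrite -(fineK finn) lee_fin; apply: le_trans hn.
  exact: ler_norm.
(* Over the length [2 * M] this pointwise bound costs [d / 2]; the two terms in [f - g] cost [d / 4]
   each. *)
have c0 : 0 < d / 4 / M by rewrite !divr_gt0.
have [e0 [e00 he0]] := uniformly_continuous_itv M cg c0.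
exists (Num.min e0 1); split; first by rewrite lt_min e00 ltr01.
move=> e eta; rewrite le_min => /andP[ee0 e1] [[deta ceta'] eta0 seta eta1].
have ceta := derivable_continuous deta.
have meta := continuous_measurable_fun ceta.
have lg := continuous_L1loc cg.
have mg := L1loc_measurable lg.
have [B [B0 beta]] := continuous_supported_bounded ceta seta.
(* The cut-off leaves the convolution on [[-M, M]] unchanged and lets [le_L1_conv] bound it by
   [d / 4]. *)
pose D := (f \- g) \_ E.
have lfg : L1loc (f \- g) by exact: locally_integrableB.
have iD : mu.-integrable setT (EFin \o D).
  rewrite -restrict_EFin; apply/(integrable_mkcond _ _).1 => //.
  by have /L1locP[_ /(_ N)] := lfg.
have mD : measurable_fun setT D by apply/measurable_EFinP; exact: measurable_int iD.
have lD : L1loc D by exact: L1_L1loc.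
have mconv (k : R -> R) : L1loc k -> measurable_fun setT (conv k eta).
  move=> lk; apply: continuous_measurable_fun; apply: derivable_continuous => x.
  by have [] := derive_conv lk deta ceta' seta x.
have iconv (k : R -> R) x : L1loc k -> mu.-integrable setT (EFin \o (fun y => k y * eta (x - y))).
  move=> lk; apply: (@integrableM_supported _ _ _ B (`|x| + e)) => //.
    exact: measurable_reflect.
  exact: supported_reflect.
have key x : x \in `[- M, M] ->
   conv f eta x = conv D eta x + conv g eta x.
  rewrite in_itv/= -ler_norml => xM.
  rewrite /conv -RintegralD//; [|exact: iconv|exact: iconv].
  apply: eq_Rintegral => y _; rewrite -mulrDl /D patchE.
  case: ifPn => [_|]; first by rewrite /= subrK.
  rewrite notin_setE /E/= in_itv/= -ler_norml => /negP; rewrite -ltNge => hy.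
  rewrite (seta (x - y)) ?mulr0//.
  have h1 : `|y : R| <= `|x| + `|x - y|.
    by rewrite -{1}[y](subKr x) (le_trans (ler_normB _ _)).
  by have := lt_le_trans hy h1; rewrite /N; lra.
have keyg x : x \in `[- M, M] -> `|conv g eta x - g x| <= d / 4 / M.
  rewrite in_itv/= -ler_norml => xM.
  have ie : mu.-integrable setT (EFin \o eta).
    apply/integrableP; split; first exact/measurable_EFinP.
    apply: (@le_lt_trans _ _ 1%E); last exact: ltry.
    rewrite -eta1 le_eqVlt; apply/orP; left; apply/eqP.
    by apply: eq_integral => z _; rewrite /= ger0_norm.
  rewrite convC// /conv.
  (* The unit mass of [eta] brings the constant [g x] under the integral. *)
  have gE : g x = \int[mu]_y (eta y * g x).
    by rewrite RintegralZr// /Rintegral eta1/= mul1r.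
  rewrite {1}gE -RintegralB//; last 2 first.
  - have lgx : L1loc (fun y => g (x - y)).
      apply: continuous_L1loc => y; apply: continuous_comp; last exact: cg.
      by apply: continuousB => //; exact: cvg_cst.
    have := @integrableM_supported _ _ eta B e lgx meta beta seta.
    by apply: eq_integrable => // y _; rewrite /= mulrC.
  - by have := integrableZr measurableT (g x) ie; apply: eq_integrable.
  rewrite -lee_fin; apply: le_trans (Rintegral_le_abs _) _.
    by apply: measurable_funB; apply: measurable_funM => //; exact: measurable_reflect.
  apply: (@le_trans _ _ (\int[mu]_y ((d / 4 / M)%:E * (eta y)%:E))%E).
    apply: ge0_le_integral => //=.
    - apply/measurable_EFinP/measurableT_comp => //.
      by apply: measurable_funB; apply: measurable_funM => //; exact: measurable_reflect.
    - by apply: measurable_funeM; exact/measurable_EFinP.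
    move=> y _; rewrite -mulrBr normrM (ger0_norm (eta0 y)) -EFinM lee_fin mulrC.
    have [ye|/seta ->] := lerP (`|y| : R) e; last by rewrite !mulr0.
    rewrite ler_wpM2r//; apply: he0 => //; exact: le_trans ee0.
  rewrite ge0_integralZl//; last 3 first.
  - exact/measurable_EFinP.
  - by move=> y _; rewrite lee_fin.
  - by rewrite lee_fin ltW.
  by rewrite eta1 mule1.
have mI (k : R -> R) : measurable_fun setT k ->
    measurable_fun (`[- M, M] : set R) (fun x => `|k x|%:E).
  by move=> mk; apply/measurable_EFinP/measurableT_comp => //; exact: measurable_funTS.
have mfgI : measurable_fun (`[- M, M] : set R) (fun x => `|f x - g x|%:E).
  by apply: mI; exact: measurable_funB.
apply: (@le_trans _ _ (\int[mu]_(x in `[(- M)%R, M])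
    (`|conv D eta x|%:E + ((d / 4 / M)%:E + `|(f x - g x)%R|%:E)))%E).
  apply: ge0_le_integral => //=.
  - by apply: mI; apply: measurable_funB => //; exact: mconv.
  - by apply: emeasurable_funD; [apply: mI; exact: mconv|exact: emeasurable_funD].
  move=> x xM; rewrite -!EFinD lee_fin.
  have := keyg _ xM; rewrite key// => k1.
  have -> : conv D eta x + conv g eta x - f x =
     conv D eta x + ((conv g eta x - g x) - (f x - g x)) by ring.
  by rewrite (le_trans (ler_normD _ _))// lerD2l (le_trans (ler_normB _ _))// lerD2r.
rewrite ge0_integralD//=; last 3 first.
- by apply: mI; exact: mconv.
- by move=> x _; rewrite -EFinD lee_fin addr_ge0// ltW.
- exact: emeasurable_funD.
rewrite ge0_integralD//=; last by move=> x _; rewrite lee_fin ltW.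
have sub : `[- M, M] `<=` E.
  by move=> x; rewrite /E/= !in_itv/= /N => /andP[? ?]; apply/andP; split; lra.
have hfg : (\int[mu]_(x in `[(- M)%R, M]) `|(f x - g x)%R|%:E <= (d / 4)%:E)%E.
  apply: le_trans hg; apply: ge0_subset_integral => //=.
  by apply/measurable_EFinP/measurableT_comp => //; apply: measurable_funTS; exact: measurable_funB.
have hD : (\int[mu]_x `|D x|%:E <= (d / 4)%:E)%E.
  apply: le_trans hg; rewrite [leRHS]integral_mkcond; apply: ge0_le_integral => //=.
  - by apply/measurable_EFinP/measurableT_comp.
  - apply/(measurable_restrictT _ _).1 => //; apply/measurable_EFinP/measurableT_comp => //.
    by apply: measurable_funTS; exact: measurable_funB.
  - by move=> x _; rewrite /D !patchE; case: ifPn => // _; rewrite normr0.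
have hc : (\int[mu]_(x in `[(- M)%R, M]) `|conv D eta x|%:E <= (d / 4)%:E)%E.
  apply: le_trans hD; apply: le_trans (le_L1_conv mD meta eta0 eta1 (mconv _ lD)).
  by apply: ge0_subset_integral => //=; apply/measurable_EFinP/measurableT_comp => //; exact: mconv.
rewrite integral_cst//= lebesgue_measure_itv/= lte_fin ifT; last by lra.
rewrite -EFinB -EFinM.
have -> : d / 4 / M * (M - - M) = d / 2 by field; lra.
apply: le_trans (leeD hc (leeD (lexx _) hfg)) _.
by rewrite -!EFinD lee_fin; lra.
Qed.

End Mollification.

(** * Smooth functions and test functions *)

Section Smooth.
Set Implicit Arguments.
Unset Strict Implicit.
Variable R : realType.
Notation mu := (@lebesgue_measure R).
Implicit Types (f g h phi eta : R -> R) (x y c B M e d : R).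

(** Coinduction for smoothness: a class of derivable functions stable under differentiation spares
    any formula for the [n]-th derivative. *)
Lemma smooth_coind (P : (R -> R) -> Prop) f :
  (forall g, P g -> (forall x, derivable g x 1) /\ P g^`()%classic) ->
  P f -> smooth f.
Proof.
move=> HP Pf n x; suff : P f^`(n)%classic by move=> /HP[].
elim: n => [|n ih]; first by rewrite derive1n0.
by rewrite derive1nS; have [] := HP _ ih.
Qed.

Lemma smooth_derivable f : smooth f -> forall x, derivable f x 1.
Proof. by move=> sf x; have := sf 0%N x; rewrite derive1n0. Qed.

Lemma smooth_derive1 f : smooth f -> smooth f^`()%classic.
Proof.
move=> sf n x; have := sf n.+1 x.
by rewrite /derive1n iterSr.
Qed.

(** The factor [s] absorbs the sign from the chain rule, which makes the family stable under
    differentiation. *)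
Lemma smooth_affine f (s c : R) : smooth f -> smooth (fun y => s * f (c - y)).
Proof.
move=> sf; pose P g := exists phi (s : R), smooth phi /\ g = (fun y => s * phi (c - y)).
apply: (@smooth_coind P); last by exists f, s.
move=> _ [phi [r [sphi ->]]].
have h y : is_derive y 1 (fun y => r * phi (c - y)) (- r * phi^`()%classic (c - y)).
  have h1 := is_derive_comp_subl (@smooth_derivable _ sphi (c - y)).
  have := @is_deriveZ _ _ _ (fun y => phi (c - y)) r y 1 _ h1.
  by rewrite /GRing.scale/= mulrN mulNr.
split; first by move=> x; have [] := h x.
exists phi^`()%classic, (- r); split; first exact: smooth_derive1.
by apply/funext => x; exact: is_derive1E (h x).
Qed.

(* The closure of the smooth functions under sums and products is stable under
   differentiation, so coinduction applies to it. *)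
Inductive smooth_generated : (R -> R) -> Prop :=
| Smooth_gen f of smooth f : smooth_generated f
| Smooth_add f g of smooth_generated f & smooth_generated g :
   smooth_generated (fun x => f x + g x)
| Smooth_mul f g of smooth_generated f & smooth_generated g :
   smooth_generated (fun x => f x * g x).

Lemma smoothM f g : smooth f -> smooth g -> smooth (fun x => f x * g x).
Proof.
move=> sf sg; apply: (@smooth_coind smooth_generated); last first.
  by apply: Smooth_mul; exact: Smooth_gen.
move=> h; elim=> {h} [h sh|h1 h2 g1 [d1 s1] g2 [d2 s2]|h1 h2 g1 [d1 s1] g2 [d2 s2]].
- by split; [exact: smooth_derivable|apply: Smooth_gen; exact: smooth_derive1].
- split; first by move=> x; apply: derivableD.
  rewrite (_ : _^`()%classic = (fun x => h1^`()%classic x + h2^`()%classic x)).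
    exact: Smooth_add.
  by apply/funext => x; rewrite !derive1E deriveD.
- split; first by move=> x; apply: derivableM.
  rewrite (_ : _^`()%classic =
    (fun x => h1 x * h2^`()%classic x + h2 x * h1^`()%classic x)).
    by apply: Smooth_add; exact: Smooth_mul.
  by apply/funext => x; rewrite !derive1E deriveM.
Qed.

Lemma test_functionP f :
  test_function f <-> smooth f /\ exists M, 0 < M /\ supported M f.
Proof.
split=> [[sf cf]|[sf [M [M0 sM]]]]; split=> //.
  have [M [M0 hM]] := compact_sub_itv cf; exists M; split=> // x xM.
  apply/eqP/negP => /negP fx0.
  have := hM _ (@subset_closure _ [set x | f x != 0] _ fx0).
  by rewrite /= in_itv/= -ler_norml leNgt xM.
apply: (@subclosed_compact _ _ `[- M, M]).
- exact: closed_closure.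
- exact: segment_compact.
have cI : closed (`[- M, M] : set R) by exact: itv_closed.
rewrite ((closure_id _).1 cI).
apply: closure_subset => x /= fx0; rewrite in_itv/= -ler_norml leNgt.
by apply/negP => /sM fx; rewrite fx eqxx in fx0.
Qed.

Lemma test_function_derive1 f : test_function f -> test_function f^`()%classic.
Proof.
move=> /test_functionP[sf [M [M0 sM]]]; apply/test_functionP.
split; first exact: smooth_derive1.
by exists M; split=> //; exact: supported_derive1.
Qed.

Lemma test_function_derivable f : test_function f -> forall x, derivable f x 1.
Proof. by move=> [/smooth_derivable]. Qed.

Lemma test_function_continuous f : test_function f -> continuous f.
Proof. by move=> tf; apply/derivable_continuous/test_function_derivable. Qed.

Lemma test_function_bounded f : test_function f -> exists M B,
  [/\ 0 < M, 0 < B, supported M f & bounded_by B f].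
Proof.
move=> tf; have /test_functionP[_ [M [M0 sM]]] := tf.
have [B [B0 hB]] := continuous_supported_bounded (test_function_continuous tf) sM.
by exists M, B.
Qed.

Lemma test_function_L1loc f : test_function f -> L1loc f.
Proof. by move=> tf; apply: continuous_L1loc; exact: test_function_continuous. Qed.

Lemma test_function_reflect f c : test_function f ->
  test_function (fun y => f (c - y)).
Proof.
move=> /test_functionP[sf [M [M0 sM]]]; apply/test_functionP; split.
  rewrite (_ : (fun y => _) = (fun y => 1 * f (c - y))); last first.
    by apply/funext => y; rewrite mul1r.
  exact: smooth_affine.
exists (`|c| + M); split; last exact: supported_reflect.
by rewrite ltr_wpDl.
Qed.

Lemma derive_conv_test f phi : L1loc f -> test_function phi ->
  (forall x, derivable (conv f phi) x 1) /\
  (conv f phi)^`()%classic = conv f phi^`()%classic.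
Proof.
move=> lf tphi; have [M [B [M0 B0 sM bB]]] := test_function_bounded tphi.
have H := derive_conv lf (test_function_derivable tphi)
  (test_function_continuous (test_function_derive1 tphi)) sM.
by split=> [x|]; [have [] := H x|apply/funext => x; have [] := H x].
Qed.

Lemma conv_continuous f phi : L1loc f -> test_function phi -> continuous (conv f phi).
Proof.
by move=> lf tphi; apply: derivable_continuous; have [] := derive_conv_test lf tphi.
Qed.

Lemma conv_measurable f phi : L1loc f -> test_function phi ->
  measurable_fun setT (conv f phi).
Proof. by move=> lf tphi; apply: continuous_measurable_fun; exact: conv_continuous. Qed.

Lemma smooth_conv f phi : L1loc f -> test_function phi -> smooth (conv f phi).
Proof.
move=> lf tphi.
pose P g := exists phi, test_function phi /\ g = conv f phi.
apply: (@smooth_coind P); last by exists phi.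
move=> _ [psi [tpsi ->]]; have [d1 ->] := derive_conv_test lf tpsi.
by split=> //; exists psi^`()%classic; split=> //; exact: test_function_derive1.
Qed.

Lemma supported_conv f g M N : supported M f -> supported N g ->
  supported (M + N) (conv f g).
Proof.
move=> sf sg x hx; rewrite /conv; rewrite (@eq_Rintegral _ _ _ _ _ (cst 0)) ?Rintegral_cst ?mul0r//.
move=> y _ /=; have [yM|/sf ->] := lerP (`|y| : R) M; last by rewrite mul0r.
rewrite (sg (x - y)) ?mulr0//.
have : `|x| <= `|y : R| + `|x - y|.
  by rewrite -{1}[x](subrK y) addrC ler_normD.
lra.
Qed.

Lemma test_function_conv f phi M : L1loc f -> 0 < M -> supported M f ->
  test_function phi -> test_function (conv f phi).
Proof.
move=> lf M0 sf tphi; apply/test_functionP; split; first exact: smooth_conv.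
have [N [B [N0 B0 sN bB]]] := test_function_bounded tphi.
by exists (M + N); split; [exact: addr_gt0|exact: supported_conv].
Qed.

End Smooth.

(** * Existence of mollifiers *)

Section Bump.
Set Implicit Arguments.
Unset Strict Implicit.
Variable R : realType.
Notation mu := (@lebesgue_measure R).
Implicit Types (f g h phi eta : R -> R) (x y c B M e d t : R) (p : {poly R}).

Lemma horner_le_expR p : exists C, forall t, 0 < t -> `|p.[t]| <= C * expR t.
Proof.
(* For [i > 0], [t^i = i^i (t/i)^i] and [t/i <= exp (t/i)]; the convention [0^0 = 1] covers the
   constant term. *)
exists (\sum_(i < size p) `|p`_i| * i%:R ^+ i) => t t0.
rewrite horner_coef mulr_suml (le_trans (ler_norm_sum _ _ _))//.
apply: ler_sum => i _; rewrite normrM -mulrA ler_wpM2l//.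
rewrite normrX (gtr0_norm t0).
case: i => -[|i] _ /=; first by rewrite !expr0 mul1r -expR0 ler_expR ltW.
have -> : t = i.+1%:R * (t / i.+1%:R) by rewrite mulrC divfK.
rewrite exprMn ler_wpM2l ?exprn_ge0// expRM_natl.
rewrite lerXn2r ?nnegrE ?expR_ge0 ?divr_ge0 ?ltW//.
by rewrite (lt_le_trans _ (expR_ge1Dx _))// ltrDr.
Qed.

(* For [p = 1] this is [exp (- 1 / x)] on the positive half-line; the family is stable
   under differentiation. *)
Definition flat p x := if 0 < x then p.[x^-1] * expR (- x^-1) else 0.

(** At [t = x^-1], the exponential bound on [p * 'X] leaves a factor [x]. This linear bound yields
    the derivative at [0]. *)
Lemma flat_le p : exists C, forall x, `|flat p x| <= C * `|x|.
Proof.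
have [C hC] := horner_le_expR (p * 'X).
exists C => x; rewrite /flat; case: ifPn => [x0|]; last first.
  have C0 : 0 <= C.
    have := hC 1 ltr01; move/(le_trans (normr_ge0 _)).
    by rewrite pmulr_lge0// expR_gt0.
  by rewrite normr0 mulr_ge0.
have := hC x^-1; rewrite invr_gt0 => /(_ x0).
rewrite hornerM hornerX !normrM (gtr0_norm (expR_gt0 _)) (gtr0_norm x0).
rewrite (gtr0_norm (x := x^-1)) ?invr_gt0//.
rewrite expRN ler_pdivrMr// => h.
by rewrite ler_pdivrMr ?expR_gt0// mulrAC.
Qed.

(** For [x > 0], differentiating [p (1/x) exp (- 1/x)] brings out [x^-2] times [p - p'] at [1/x],
    whence the polynomial. *)
Lemma is_derive_flat p x : is_derive x 1 (flat p) (flat ('X^2 * (p - p^`())) x).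
Proof.
have [x0|x0|->] := ltgtP x 0.
- rewrite {2}/flat ltNge (ltW x0)/=.
  apply: (near_eq_is_derive (f := cst 0)).
  near=> y; rewrite /flat ltNge (_ : y <= 0)//.
  by near: y; apply: filterS (lt_nbhsl x0) => y /ltW.
- rewrite {2}/flat x0.
  apply: (near_eq_is_derive (f := fun y => p.[y^-1] * expR (- y^-1))).
    by near=> y; rewrite /flat (_ : 0 < y)//; near: y; exact: lt_nbhsr.
  have dV : is_derive x 1 (fun y : R => y^-1) (- x ^- 2).
    have := @is_deriveV _ id x 1 1; rewrite /GRing.scale/= mulr1; apply.
    by rewrite gt_eqF.
  have d1 := @is_derive1_comp R (horner p) _ x _ _ (is_derive_poly p x^-1) dV.
  have dN : is_derive x 1 (fun y : R => - y^-1) (x ^- 2).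
    by have := is_deriveN dV; rewrite opprK.
  have dE : is_derive (- x^-1) 1 (@expR R) (expR (- x^-1)) by exact: is_derive_expR.
  have d2 := @is_derive1_comp R (@expR R) _ x _ _ dE dN.
  have d3 := is_deriveM d1 d2.
  refine (@is_derive_eq _ _ _ _ _ _ _ _ d3 _).
  rewrite -[LHS]/(p.[x^-1] * (expR (- x^-1) * x ^- 2) +
    expR (- x^-1) * (p^`().[x^-1] * - x ^- 2)) hornerM hornerXn hornerD hornerN exprVn; ring.
- rewrite {2}/flat ltxx.
  (* The difference quotient at [0] is [flat (p * 'X)], which tends to [0] by the linear bound. *)
  have [C hC] := flat_le (p * 'X).
  have key (h : R) : h^-1 * flat p h = flat (p * 'X) h.
    rewrite /flat; case: ifP => _; last by rewrite mulr0.
    by rewrite hornerM hornerX mulrCA mulrA.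
  have cv : h^-1 *: (flat p (h *: 1 + 0) - flat p 0) @[h --> 0^'] --> (0 : R).
    apply/cvgrPdist_le => e e0; near=> h.
    rewrite [flat p 0]/flat ltxx subr0 addr0 /GRing.scale/= mulr1 key sub0r normrN.
    apply: (le_trans (hC h)); apply: (@le_trans _ _ (`|C| * `|h|)).
      by rewrite ler_wpM2r// ler_norm.
    apply: (@le_trans _ _ ((`|C| + 1) * `|h|)); first by rewrite ler_wpM2r// lerDl.
    rewrite mulrC -ler_pdivlMr ?ltr_pwDr//.
    near: h; apply: dnbhs0_le; by rewrite divr_gt0// ltr_pwDr.
  apply: DeriveDef; first by apply/cvg_ex; exists 0.
  exact: cvg_lim cv.
Unshelve. all: by end_near. Qed.

Lemma smooth_flat p : smooth (flat p).
Proof.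
apply: (@smooth_coind _ (fun g => exists p, g = flat p)); last by exists p.
move=> _ [q ->]; split; first by move=> x; have [] := is_derive_flat q x.
by exists ('X^2 * (q - q^`())); apply/funext => x; exact: is_derive1E (is_derive_flat q x).
Qed.

Lemma mollifier_exists e : 0 < e -> exists eta, test_function eta /\ mollifier e eta.
Proof.
(* [b] is positive exactly on []-e, e[]; writing [e + x] as [e - (0 - x)] suits [smooth_affine]. *)
move=> e0; pose b x := flat 1 (e - x) * flat 1 (e - (0 - x)).
have sf c : smooth (fun x => flat 1 (c - x)).
  by have := @smooth_affine _ _ 1 c (@smooth_flat 1); under [X in smooth X]eq_fun do rewrite mul1r.
have fl0 x : 0 <= flat 1 x by rewrite /flat; case: ifP => // _; rewrite hornerE mul1r expR_ge0.
have sb : smooth b.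
  apply: smoothM; first exact: sf.
  have := @smooth_affine _ _ 1 0 (sf e); under [X in smooth X]eq_fun do rewrite mul1r.
  by [].
have b0 x : 0 <= b x by rewrite mulr_ge0.
have supb : supported e b.
  move=> x; rewrite ltr_normr => /orP[] h; rewrite /b /flat.
    by rewrite ltNge (_ : e - x <= 0) ?mul0r//; lra.
  by rewrite [X in _ * X]ifF ?mulr0//; apply/negbTE; rewrite -leNgt; lra.
have tb : test_function b by apply/test_functionP; split=> //; exists e.
pose I := \int[mu]_x b x.
have ib : mu.-integrable setT (EFin \o b).
  have [M [B [M0 B0 sM bB]]] := test_function_bounded tb.
  have l1 : L1loc (cst (1 : R)) by apply: continuous_L1loc => x; exact: cvg_cst.
  have := integrableM_supported l1 (L1loc_measurable (test_function_L1loc tb)) bB sM.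
  by apply: eq_integrable => // x _ /=; rewrite mul1r.
have IE : (I%:E = \int[mu]_x (b x)%:E)%E by exact: EFin_Rintegral.
have I0 : 0 < I.
  (* On [[-e/2, e/2]] both arguments of [flat 1] are at least [e / 2], so [b >= m * m] on a set of
     length [e]. *)
  pose m := expR (- (e / 2)^-1).
  have e2 : 0 < e / 2 by rewrite divr_gt0.
  have mb x : x \in `[- (e / 2), e / 2] -> m * m <= b x.
    rewrite in_itv/= => /andP[h1 h2].
    have fm y : e / 2 <= y -> m <= flat 1 y.
      move=> ey; have y0 := lt_le_trans e2 ey.
      by rewrite /flat y0 hornerE mul1r ler_expR lerN2 lef_pV2// posrE.
    by apply: ler_pM; rewrite ?expR_ge0//; apply: fm; lra.
  apply: (@lt_le_trans _ _ (m * m * e)); first by rewrite !mulr_gt0// expR_gt0.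
  have mb' := continuous_measurable_fun (test_function_continuous tb).
  rewrite -lee_fin IE.
  apply: (@le_trans _ _ (\int[mu]_(x in `[(- (e / 2))%R, (e / 2)%R]) (m * m)%:E)%E).
    rewrite integral_cst//= lebesgue_measure_itv/= lte_fin ifT; last by lra.
    by rewrite -EFinB -EFinM lee_fin opprK -splitr.
  apply: (@le_trans _ _ (\int[mu]_(x in `[(- (e / 2))%R, (e / 2)%R]) (b x)%:E)%E).
    apply: ge0_le_integral => //=.
    - by move=> x _; rewrite lee_fin mulr_ge0// expR_ge0.
    - by apply/measurable_EFinP; exact: measurable_funTS.
  by apply: ge0_subset_integral => //=; [exact/measurable_EFinP|move=> x _; rewrite lee_fin].
(* The reflection preserves the support radius and the integral, and gives the shape handled by
   [smooth_affine]. *)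
have seta : smooth (fun y => I^-1 * b (0 - y)) by exact: smooth_affine.
have supe : supported e (fun y => I^-1 * b (0 - y)).
  by move=> y ye; rewrite supb ?mulr0// sub0r normrN.
have te : test_function (fun y => I^-1 * b (0 - y)).
  by apply/test_functionP; split=> //; exists e.
exists (fun y => I^-1 * b (0 - y)); split=> //; split=> //.
- split; first exact: test_function_derivable.
  exact/test_function_continuous/test_function_derive1.
- by move=> x; rewrite mulr_ge0// invr_ge0 ltW.
- have mb := L1loc_measurable (test_function_L1loc tb).
  rewrite (@integral_reflect _ 0 (fun x => (I^-1 * b x)%:E)); last first.
    by apply/measurable_EFinP/measurable_funM.
  under eq_integral do rewrite EFinM.
  by rewrite integralZl// -IE -EFinM mulVf// gt_eqF.
Qed.

End Bump.

(** * Fractional derivatives of test functions *)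

Section FractionalDerivative.
Set Implicit Arguments.
Unset Strict Implicit.
Variables (R : realType) (a : R).
Hypotheses (a0 : 0 < a) (a1 : a < 1).
Notation mu := (@lebesgue_measure R).
Implicit Types (f g h phi eta : R -> R) (x y c B M e t : R) (d : side).

(** The Riemann-Liouville kernel of order [1 - a] without its Gamma factor, which [frac_coef]
    carries together with the sign. *)
Definition riesz_kernel t := if 0 < t then (t `^ a)^-1 else 0.

Definition kernel d t :=
  match d with Left => riesz_kernel t | Right => riesz_kernel (- t) end.

Lemma kernel_opposite d t : kernel (opposite d) t = kernel d (- t).
Proof. by case: d => //=; rewrite opprK. Qed.

Lemma riesz_kernel_ge0 t : 0 <= riesz_kernel t.
Proof. by rewrite /riesz_kernel; case: ifP => // _; rewrite invr_ge0 powR_ge0. Qed.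

Lemma measurable_riesz_kernel : measurable_fun setT riesz_kernel.
Proof.
apply: measurable_fun_if => //.
  by apply: measurable_fun_ltr.
apply: measurable_funTS.
rewrite (_ : (fun x => _) = (fun x => x `^ (- a))); last first.
  by apply/funext => x; rewrite powRN.
exact: measurable_powR.
Qed.

(** The antiderivative [x^(1 - a) / (1 - a)] is nonnegative at [e]; dropping it makes the bound
    uniform as [e] tends to [0]. *)
Lemma integral_riesz_kernel_le e M : 0 < e -> e < M ->
  (\int[mu]_(x in `[e, M]) (riesz_kernel x)%:E <= (M `^ (1 - a) / (1 - a))%:E)%E.
Proof.
move=> e0 eM.
pose F x := x `^ (1 - a) * (1 - a)^-1.
have dF x : 0 < x -> is_derive x 1 F ((x `^ a)^-1).
  move=> x0; have d3 := @is_deriveM _ _ _ _ x 1 _ _ (is_derive1_powR (1 - a) x0)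
    (is_derive_cst ((1 - a)^-1) x 1).
  refine (@is_derive_eq _ _ _ _ _ _ _ _ d3 _).
  rewrite scaler0 add0r /GRing.scale/= mulrA mulVf ?mul1r; last by rewrite gt_eqF ?subr_gt0.
  by rewrite (_ : 1 - a - 1 = - a) ?powRN//; ring.
have cF x : 0 < x -> {for x, continuous F}.
  move=> /dF [+ _]; move=> ?; exact/differentiable_continuous/derivable1_diffP.
have ck : {within `[e, M], continuous riesz_kernel}.
  apply: derivable_within_continuous => x; rewrite in_itv/= => /andP[ex _].
  have x0 := lt_le_trans e0 ex.
  apply: (near_eq_derivable (f := fun x => x `^ (- a))).
    near=> y; rewrite /riesz_kernel powRN ifT//; near: y; exact: lt_nbhsr.
  by apply: derivable_powR; rewrite in_itv/= x0.
rewrite (@continuous_FTC2 R riesz_kernel F e M eM ck).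
- by rewrite -EFinB lee_fin gerBl mulr_ge0 ?powR_ge0// invr_ge0 subr_ge0 ltW.
- split.
  + by move=> x; rewrite in_itv/= => /andP[/(lt_trans e0) x0 _]; have [] := dF _ x0.
  + by apply: cvg_at_right_filter; exact: cF.
  + by apply: cvg_at_left_filter; apply: cF; exact: lt_trans eM.
- move=> x; rewrite in_itv/= => /andP[/(lt_trans e0) x0 _].
  by rewrite (is_derive1E (dF _ x0)) /riesz_kernel x0.
Unshelve. all: by end_near. Qed.

Lemma L1loc_riesz_kernel : L1loc riesz_kernel.
Proof.
have mk := measurable_riesz_kernel.
apply/L1locP; split=> // M0; pose M := `|M0| + 1.
have M1 : 0 < M by rewrite ltr_wpDl.
suff : mu.-integrable `[- M, M] (EFin \o riesz_kernel).
  apply: integrableS => //.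
  move=> x /=; rewrite !in_itv/= -!ler_norml => /le_trans; apply.
  by rewrite /M (le_trans (ler_norm _))// lerDl.
apply/integrableP; split; first by apply/measurable_EFinP; exact: measurable_funTS.
(* The fundamental theorem of calculus applies away from the singularity; monotone convergence along
   these intervals reaches []0, M]]. *)
pose F n := `[n.+1%:R^-1, M]%classic : set R.
have mkE D : measurable_fun D (fun x => (riesz_kernel x)%:E).
  by apply/measurable_EFinP; exact: measurable_funTS.
have ndF : nondecreasing_seq F.
  move=> m n mn; rewrite subsetEset => x /=; rewrite ?/F /= !in_itv/= => /andP[h ->].
  by rewrite andbT (le_trans _ h)// lef_pV2 ?posrE// ler_nat.
have bF : \bigcup_n F n = `]0, M]%classic.
  apply/seteqP; split=> [x [n _]|x] /=; rewrite /F/= !in_itv/= => /andP[h hM].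
    by rewrite hM andbT (lt_le_trans _ h).
  have [n hn] := ltr_add_invr h; exists n => //=.
  by rewrite in_itv/= hM andbT; move: hn; rewrite add0r => /ltW.
have H : (\int[mu]_(x in F i) (riesz_kernel x)%:E @[i --> \oo] -->
    \int[mu]_(x in `]0%R, M]) (riesz_kernel x)%:E)%E.
  rewrite -bF; apply: ge0_nondecreasing_set_cvg_integral => //.
  - by move=> i; exact: measurable_itv.
  - by move=> i; exact: mkE.
  - by move=> i x _; rewrite lee_fin riesz_kernel_ge0.
apply: (@le_lt_trans _ _ (M `^ (1 - a) / (1 - a))%:E); last exact: ltry.
have -> : (\int[mu]_(x in `[(- M)%R, M]) `|(EFin \o riesz_kernel) x| =
   \int[mu]_(x in `]0%R, M]) (riesz_kernel x)%:E)%E.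
  rewrite integral_mkcond [RHS]integral_mkcond; apply: eq_integral => x _.
  rewrite !patchE /= !mem_setE !in_itv/=.
  rewrite (ger0_norm (riesz_kernel_ge0 x)).
  case: ifPn => [/andP[_ ->]|]; first by rewrite andbT /riesz_kernel; case: ifP.
  rewrite negb_and -!ltNge => /orP[] h; first by rewrite (ltNge 0) (_ : x <= 0)//; lra.
  by rewrite leNgt h andbF.
rewrite -(cvg_lim _ H)//; apply: lime_le; first by apply/cvg_ex; eexists; exact: H.
apply: nearW => n; have [nM|nM] := ltP n.+1%:R^-1 M.
  exact: integral_riesz_kernel_le.
(* Here [M <= 1/(n+1)], so the interval is a point or empty. *)
apply: (@le_trans _ _ 0%E); last by rewrite lee_fin divr_ge0 ?powR_ge0// subr_ge0 ltW.
move: nM; rewrite /F le_eqVlt => /predU1P[->|nM].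
  by rewrite set_itv1 integral_set1.
by rewrite set_itv_ge ?integral_set0// bnd_simp -ltNge.
Qed.

Lemma L1loc_opp f : L1loc f -> L1loc (fun y => f (- y)).
Proof.
move=> /L1locP[mf lf]; apply/L1locP; split; first exact: measurableT_comp.
move=> M; apply/integrableP; split.
  by apply/measurable_EFinP/measurable_funTS; exact: measurableT_comp.
have /integrableP[_] := lf M; apply: le_lt_trans.
rewrite integral_mkcond [leRHS]integral_mkcond.
rewrite -(@ge0_integral_reflect _ 0 ((fun x => `|(EFin \o f) x|)%E \_ _)).
- rewrite le_eqVlt; apply/orP; left; apply/eqP; apply: eq_integral => x _.
  by rewrite !patchE !mem_setE !in_itv/= sub0r lerN2 lerNl andbC.
- apply/(measurable_restrictT _ _).1 => //; apply/measurable_EFinP/measurableT_comp => //.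
  exact: measurable_funTS.
- by move=> x; rewrite patchE; case: ifP.
Qed.

Lemma L1loc_kernel d : L1loc (kernel d).
Proof. by case: d; [|apply: L1loc_opp]; exact: L1loc_riesz_kernel. Qed.

Lemma kernel_decay (e : R) : 0 < e ->
  exists T, 0 < T /\ forall d t, T <= `|t| -> `|kernel d t| <= e.
Proof.
move=> e0; pose T := e^-1 `^ a^-1.
have T0 : 0 < T by rewrite powR_gt0// invr_gt0.
have TE : T `^ a = e^-1 by rewrite /T -powRrM mulVf ?gt_eqF// powRr1// invr_ge0 ltW.
have H t : T <= `|t| -> `|riesz_kernel t| <= e.
  rewrite (ger0_norm (riesz_kernel_ge0 t)) /riesz_kernel => Tt.
  case: ifPn => [t0|_]; last exact: ltW.
  rewrite -[leRHS]invrK lef_pV2 ?posrE ?powR_gt0// ?invr_gt0// -TE.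
  rewrite gtr0_norm// in Tt.
  by apply: ge0_ler_powR => //; rewrite ?nnegrE ltW.
by exists T; split=> // -[] t /=; [|rewrite -normrN]; exact: H.
Qed.

Lemma frac_integralE d f x :
  frac_integral d (1 - a) f x = (Gamma (1 - a))^-1 * conv f (kernel d) x.
Proof.
case: d => /=; congr (_ * _); rewrite Rintegral_mkcond; apply: eq_Rintegral => y _;
  rewrite patchE mem_setE in_itv/= ?andbT /riesz_kernel subKr ?opprB.
- by rewrite subr_gt0; case: ifP => _ //; rewrite mulr0.
- by rewrite subr_gt0; case: ifP => _ //; rewrite mulr0.
Qed.

Definition frac_coef d : R :=
  match d with Left => (Gamma (1 - a))^-1 | Right => - (Gamma (1 - a))^-1 end.

(** The kernel is singular, so the derivative must fall on [phi]: [convC] makes the kernel the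
    locally integrable factor of the differentiation rule. *)
Lemma frac_derivativeE d phi x : test_function phi ->
  frac_derivative d a phi x = frac_coef d * conv (kernel d) phi^`()%classic x.
Proof.
move=> tphi.
have H d' : (frac_integral d' (1 - a) phi)^`()%classic x =
    (Gamma (1 - a))^-1 * conv (kernel d') phi^`()%classic x.
  have lk := L1loc_kernel d'; have lphi := test_function_L1loc tphi.
  have [dc <-] := derive_conv_test lk tphi.
  rewrite -derive1Ml//; congr (_^`()%classic x); apply/funext => y.
  by rewrite frac_integralE convC//; exact: L1loc_measurable.
by case: d => /=; rewrite H// mulNr.
Qed.

End FractionalDerivative.

(** * Reflection, decay and fractional integration by parts *)

Section WeakDerivative.
Set Implicit Arguments.
Unset Strict Implicit.
Variables (R : realType) (a : R).
Hypotheses (a0 : 0 < a) (a1 : a < 1).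
Notation mu := (@lebesgue_measure R).
Implicit Types (f g h phi eta u v : R -> R) (x y c B M e t : R) (d : side).

Lemma frac_derivative_funE d phi : test_function phi ->
  frac_derivative d a phi =
  (fun x => frac_coef a d * conv (kernel a d) phi^`()%classic x).
Proof. by move=> tphi; apply/funext => x; exact: frac_derivativeE. Qed.

(** Reflection changes the side of the kernel, the sign of [phi'] and that of [frac_coef]; the two
    signs cancel. This turns the weak identity tested on [phi (x - .)] into a statement on
    convolutions. *)
Lemma frac_derivative_reflect d phi x y : test_function phi ->
  frac_derivative (opposite d) a (fun z => phi (x - z)) y =
  frac_derivative d a phi (x - y).
Proof.
move=> tphi.
rewrite (frac_derivativeE a1 (opposite d) y (test_function_reflect x tphi)).
rewrite (frac_derivativeE a1 d (x - y) tphi).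
have -> : (fun z => phi (x - z))^`()%classic = (fun z => - phi^`()%classic (x - z)).
  apply/funext => z; apply: is_derive1E; apply: is_derive_comp_subl.
  exact: test_function_derivable.
have tphi' := test_function_derive1 tphi.
have lk := L1loc_kernel a1 d.
have mk := L1loc_measurable lk.
have [M [B [M0 B0 sM bB]]] := test_function_bounded tphi'.
have mphi' := L1loc_measurable (test_function_L1loc tphi').
have -> : frac_coef a (opposite d) = - frac_coef a d by case: d {lk mk} => //=; rewrite opprK.
rewrite mulNr -mulrN; congr (_ * _).
rewrite [RHS]/conv -[RHS](@Rintegral_reflect _ 0); last first.
  by apply: measurable_funM => //; exact: measurable_reflect.
rewrite /conv.
under eq_Rintegral do rewrite kernel_opposite mulrN.
under [RHS]eq_Rintegral do rewrite sub0r opprK.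
rewrite -mulN1r -RintegralZl//.
  by apply: eq_Rintegral => z _; rewrite mulN1r opprK opprB addrA addrAC.
rewrite (_ : EFin \o _ =
    (fun z => (kernel a d (- z) * - phi^`()%classic (x - (y - z)))%:E)); last first.
  by apply/funext => z /=; rewrite mulrN.
have H := @integrableM_supported _ (fun z => kernel a d (- z))
  (fun z => - phi^`()%classic (x - (y - z))) B (`|y - x| + M).
apply: H.
- exact: L1loc_opp.
- apply: measurable_funN; apply: (@measurableT_comp _ _ _ _ _ _ phi^`()%classic) => //.
  by apply: measurable_funB => //; exact: measurable_funB.
- by move=> z; rewrite normrN.
- move=> z hz; rewrite sM ?oppr0//.
  have : `|z : R| <= `|y - x| + `|x - (y - z)|.
    by rewrite -{1}[z](_ : (y - x) + (x - (y - z)) = z) ?ler_normD//; ring.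
  by have := hz; lra.
Qed.

Lemma frac_derivative_continuous d phi : test_function phi ->
  continuous (frac_derivative d a phi).
Proof.
move=> tphi; rewrite frac_derivative_funE// => x.
apply: cvgM; first exact: cvg_cst.
exact: (conv_continuous (L1loc_kernel a1 d) (test_function_derive1 tphi)).
Qed.

Lemma frac_derivative_measurable d phi : test_function phi ->
  measurable_fun setT (frac_derivative d a phi).
Proof.
by move=> tphi; apply: continuous_measurable_fun; exact: frac_derivative_continuous.
Qed.

(** As [phi'] lives in [[-M, M]], for [|x| > T + M] the convolution meets the kernel only at
    arguments of size at least [T]. *)
Lemma frac_derivative_decay d phi e : test_function phi -> 0 < e ->
  exists T, 0 < T /\ forall x, T < `|x| -> `|frac_derivative d a phi x| <= e.
Proof.
move=> tphi e0.
have tphi' := test_function_derive1 tphi.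
have [M [B [M0 B0 sM bB]]] := test_function_bounded tphi'.
have mphi' := L1loc_measurable (test_function_L1loc tphi').
have lk := L1loc_kernel a1 d.
have mk := L1loc_measurable lk.
pose I := (\int[mu]_x `|phi^`()%classic x|%:E)%E.
have Ioo : (I < +oo)%E.
  rewrite /I (ge0_integral_supported sM).
  by have /L1locP[_ /(_ M)/integrableP[]] := test_function_L1loc tphi'.
have I0 : (0 <= I)%E by apply: integral_ge0.
have Ifin : I \is a fin_num by rewrite ge0_fin_numE.
(* A kernel bound [e / c] becomes [e] after the coefficient and the norm of [phi']; the [+ 1] keeps
   [c] positive. *)
pose c := `|frac_coef a d| * fine I + 1.
have c0 : 0 < c by rewrite ltr_wpDl// mulr_ge0// fine_ge0.
have [T [T0 hT]] := kernel_decay a0 (divr_gt0 e0 c0).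
exists (T + M); split=> [|x hx]; first exact: addr_gt0.
rewrite frac_derivativeE// normrM.
suff h : `|conv (kernel a d) phi^`()%classic x| <= e / c * fine I.
  apply: (@le_trans _ _ (`|frac_coef a d| * (e / c * fine I))).
    exact: ler_wpM2l.
  have -> : `|frac_coef a d| * (e / c * fine I) = e * (`|frac_coef a d| * fine I / c) by ring.
  by rewrite ler_piMr ?(ltW e0)// ler_pdivrMr// mul1r /c lerDl ler01.
rewrite -lee_fin EFinM fineK//.
apply: le_trans (Rintegral_le_abs _) _.
  by apply: measurable_funM => //; exact: measurable_reflect.
rewrite /I -(@ge0_integral_reflect _ x (fun x => `|phi^`()%classic x|%:E))//; last first.
  by apply/measurable_EFinP/measurableT_comp.
have ec : 0 <= e / c by rewrite divr_ge0// ltW.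
rewrite -ge0_integralZl//; last first.
  by apply/measurable_EFinP/measurableT_comp => //; exact: measurable_reflect.
apply: ge0_le_integral => //=.
- apply/measurable_EFinP/measurableT_comp => //; apply: measurable_funM => //.
  exact: measurable_reflect.
- apply: measurable_funeM; apply/measurable_EFinP/measurableT_comp => //.
  exact: measurable_reflect.
move=> y _; rewrite -EFinM lee_fin normrM.
have [yM|yM] := lerP `|x - y : R| M; last by rewrite sM// normr0 !mulr0.
rewrite ler_wpM2r// hT//.
have : `|x| <= `|y : R| + `|x - y|.
  by rewrite -{1}[x](subrK y) addrC ler_normD.
by have := hx; have := yM; lra.
Qed.

Lemma frac_derivative_bounded d phi : test_function phi ->
  exists B, 0 < B /\ bounded_by B (frac_derivative d a phi).
Proof.
move=> tphi; have cD := frac_derivative_continuous (d := d) tphi.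
have [T [T0 hT]] := frac_derivative_decay d tphi ltr01.
have cK : compact [set frac_derivative d a phi x | x in `[- T, T]].
  by apply: continuous_compact; [exact: continuous_subspaceT|exact: segment_compact].
have [B [B0 hB]] := compact_sub_itv cK.
exists (B + 1); split=> [|x]; first exact: addr_gt0.
have [xT|xT] := lerP `|x| T; last by rewrite (le_trans (hT _ xT))// lerDr ltW.
have := hB (frac_derivative d a phi x); rewrite /= in_itv/= -ler_norml => h.
rewrite (le_trans (h _)) ?lerDl//.
by exists x => //=; rewrite in_itv/= -ler_norml.
Qed.

(** Integration by parts in convolution form: [h] will be the kernel, [psi] a reflected test
    function and [x = 0]. *)
Lemma conv_derive1_swap h u psi x : L1loc h -> test_function u -> test_function psi ->
  conv (conv h u^`()%classic) psi x = conv u (conv h psi^`()%classic) x.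
Proof.
move=> lh tu tpsi.
have tu' := test_function_derive1 tu.
have tpsi' := test_function_derive1 tpsi.
have lu := test_function_L1loc tu; have lpsi := test_function_L1loc tpsi.
have [Mu [Bu [_ _ sMu _]]] := test_function_bounded tu.
have [Mp [Bp [_ _ sMp _]]] := test_function_bounded tpsi.
have [Mu' [Bu' [_ _ sMu' bBu']]] := test_function_bounded tu'.
have [Mp' [Bp' [_ _ sMp' bBp']]] := test_function_bounded tpsi'.
have mu' := L1loc_measurable (test_function_L1loc tu').
have mp' := L1loc_measurable (test_function_L1loc tpsi').
(* Both sides are the derivative of [psi * u = u * psi]. *)
have E1 : conv psi u^`()%classic = conv u psi^`()%classic.
  have [_ <-] := derive_conv_test lpsi tu.
  rewrite (convC (L1loc_measurable lpsi) (L1loc_measurable lu)).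
  by have [_ ->] := derive_conv_test lu tpsi.
rewrite (convC (conv_measurable lh tu') (L1loc_measurable lpsi)).
rewrite -(conv_conv x lh lpsi sMp mu' bBu' sMu') E1.
exact: conv_conv lh lu sMu mp' bBp' sMp'.
Qed.

(** A pairing with [phi] is the value at [0] of a convolution with its reflection, the form that
    [conv_derive1_swap] handles. *)
Lemma Rintegral_frac_derivative_test d u phi : test_function u -> test_function phi ->
  \int[mu]_x (frac_derivative d a u x * phi x) =
  frac_coef a d * conv (conv (kernel a d) u^`()%classic) (fun y => phi (0 - y)) 0.
Proof.
move=> tu tphi; have tpsi := test_function_reflect 0 tphi.
have tu' := test_function_derive1 tu.
have lk := L1loc_kernel a1 d.
have [Mp [Bp [_ _ sMp bBp]]] := test_function_bounded tphi.
have lck : L1loc (conv (kernel a d) u^`()%classic).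
  exact: continuous_L1loc (conv_continuous lk tu').
rewrite /conv -RintegralZl//.
  by apply: eq_Rintegral => x _; rewrite frac_derivativeE// mulrA subKr.
apply: (@integrableM_supported _ _ _ Bp Mp) => //.
- have mphi := L1loc_measurable (test_function_L1loc tphi).
  exact: measurable_reflect (measurable_reflect 0 mphi).
- by move=> x; rewrite subKr; exact: sMp.
Qed.

Lemma is_weak_frac_derivative_test d u : test_function u ->
  is_weak_frac_derivative d a u (frac_derivative d a u).
Proof.
move=> tu; split; first exact: continuous_L1loc (frac_derivative_continuous (d := d) tu).
move=> phi tphi.
have tpsi := test_function_reflect 0 tphi.
have lk := L1loc_kernel a1 d.
rewrite Rintegral_frac_derivative_test// (conv_derive1_swap 0 lk tu tpsi).
rewrite {1}/conv -RintegralZl//; last first.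
  have [Mu [Bu [_ _ sMu bBu]]] := test_function_bounded tu.
  have lr : L1loc (fun x => conv (kernel a d) (fun y => phi (0 - y))^`()%classic (0 - x)).
    under eq_fun do rewrite sub0r.
    apply: (@L1loc_opp _ (conv (kernel a d) (fun y => phi (0 - y))^`()%classic)).
    exact: continuous_L1loc (conv_continuous lk (test_function_derive1 tpsi)).
  have lu := test_function_L1loc tu.
  have := @integrableM_supported _ _ _ Bu Mu lr (L1loc_measurable lu) bBu sMu.
  by apply: eq_integrable => // x _ /=; rewrite mulrC.
apply: eq_Rintegral => x _.
(* As a double reflection, [phi] fits [frac_derivative_reflect], which exchanges the sides. *)
have E : phi = (fun y => (fun y => phi (0 - y)) (0 - y)).
  by apply/funext => y; rewrite subKr.
by rewrite [in RHS]E (frac_derivative_reflect d 0 x tpsi) (frac_derivativeE a1 d _ tpsi) mulrCA.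
Qed.

End WeakDerivative.

(** * Passage to the limit and truncation in [L^1] *)

Section Approximation.
Set Implicit Arguments.
Unset Strict Implicit.
Variables (R : realType) (a : R).
Hypotheses (a0 : 0 < a) (a1 : a < 1).
Notation mu := (@lebesgue_measure R).
Implicit Types (f g h phi eta u v : R -> R) (x y c B M e t : R) (d : side).

Lemma ge0_cvge0P (X : nat -> \bar R) : (forall n, 0 <= X n)%E ->
  (X @ \oo --> 0%E) <-> (forall e, 0 < e -> \forall n \near \oo, (X n <= e%:E)%E).
Proof.
move=> X0; split=> [/fine_cvgP[fin cvg] e e0|H].
  have /cvgr0_norm_le/(_ _ e0) := cvg.
  apply: filterS2 fin => n finn hn.
  rewrite -(fineK finn) lee_fin; apply: le_trans hn; exact: ler_norm.
apply/fine_cvgP; split.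
  apply: filterS (H 1 ltr01) => n Xn; rewrite ge0_fin_numE//.
  by apply: le_lt_trans Xn _; exact: ltry.
apply/cvgrPdist_le => e e0; apply: filterS (H e e0) => n Xn /=.
rewrite sub0r normrN ger0_norm ?fine_ge0// -lee_fin fineK// ge0_fin_numE//.
by apply: le_lt_trans Xn _; exact: ltry.
Qed.

Lemma L1_integrableM f g B : L1 f -> measurable_fun setT g -> 0 <= B ->
  bounded_by B g -> mu.-integrable setT (EFin \o (fun y => f y * g y)).
Proof.
move=> l1f mg B0 bg; have mf := L1loc_measurable (L1_L1loc l1f).
apply/integrableP; split; first by apply/measurable_EFinP; exact: measurable_funM.
apply: (@le_lt_trans _ _ (B%:E * \int[mu]_x `|f x|%:E)%E).
  by apply: le_integralM_supported => //; move=> x; case.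
by apply: lte_mul_pinfty => //; have /integrableP[] := l1f.
Qed.

(** The set [A] lets one estimate serve both modes of convergence: an interval for [L^1_loc], the
    whole line for [L^1]. *)
Lemma dist_RintegralM f g h B (A : set R) : measurable A ->
  measurable_fun setT f -> measurable_fun setT g -> measurable_fun setT h -> 0 <= B ->
  bounded_by B h -> (forall x, ~ A x -> h x = 0) ->
  mu.-integrable setT (EFin \o (fun y => f y * h y)) ->
  mu.-integrable setT (EFin \o (fun y => g y * h y)) ->
  (`|\int[mu]_x (f x * h x) - \int[mu]_x (g x * h x)|%:E <=
    B%:E * \int[mu]_(x in A) `|(f x - g x)%R|%:E)%E.
Proof.
move=> mA mf mg mh B0 bh sh fh gh.
rewrite -RintegralB//.
under eq_Rintegral do rewrite -mulrBl.
have mfg : measurable_fun setT (fun x => f x - g x) by exact: measurable_funB.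
apply: le_trans (Rintegral_le_abs _) _; first exact: measurable_funM.
exact: (le_integralM_supported mA mfg mh B0 bh sh).
Qed.

(** Local convergence suffices for [w_] because [phi] has compact support; on the other side the
    derivative of [phi] is only known to be bounded, so [u_] has to converge in [L^1]. *)
Lemma is_weak_frac_derivative_closed d u v (u_ w_ : nat -> R -> R) :
  L1 u -> L1loc v -> (forall j, L1 (u_ j)) ->
  (forall j, is_weak_frac_derivative d a (u_ j) (w_ j)) ->
  cvg_L1 u_ u -> cvg_L1loc w_ v -> is_weak_frac_derivative d a u v.
Proof.
move=> l1u lv l1u_ weak cu cw; split=> // phi tphi.
have [M [B [M0 B0 sM bB]]] := test_function_bounded tphi.
have mphi := L1loc_measurable (test_function_L1loc tphi).
have [C [C0 bC]] := frac_derivative_bounded a0 a1 (opposite d) tphi.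
have mD := frac_derivative_measurable a1 (opposite d) tphi.
apply/eqP; rewrite -subr_eq0 -normr_le0; apply/ler_addgt0Pl => e e0; rewrite addr0.
have e1 : 0 < e / 2 / B by rewrite !divr_gt0.
have e2 : 0 < e / 2 / C by rewrite !divr_gt0.
have cvgP (X : nat -> \bar R) r : (forall n, 0 <= X n)%E -> X @ \oo --> 0%E -> 0 < r ->
    \forall n \near \oo, (X n <= r%:E)%E.
  by move=> X0 cX r0; apply: (ge0_cvge0P X0).1.
have cK : compact `[- M, M] by exact: segment_compact.
have N1 : \forall j \near \oo,
    (\int[mu]_x `|(u_ j x - u x)%R|%:E <= (e / 2 / C)%:E)%E.
  by apply: cvgP cu e2 => n; apply: integral_ge0.
have N2 : \forall j \near \oo,
    (\int[mu]_(x in `[(- M)%R, M]) `|(w_ j x - v x)%R|%:E <= (e / 2 / B)%:E)%E.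
  by apply: cvgP (cw _ cK) e1 => n; apply: integral_ge0.
have [j [hu hw]] := filter_ex (filterI N1 N2).
have [lw weakj] := weak j.
set D := frac_derivative (opposite d) a phi.
have iw : `|\int[mu]_x (w_ j x * phi x) - \int[mu]_x (v x * phi x)| <= e / 2.
  rewrite -lee_fin.
  apply: le_trans (dist_RintegralM (A := `[- M, M]) (B := B) _ _ _ _ _ _ _ _ _) _ => //.
  - exact: L1loc_measurable.
  - exact: L1loc_measurable.
  - exact: ltW.
  - by move=> x /negP; rewrite in_itv/= -ler_norml -ltNge => /sM.
  - exact: (@integrableM_supported _ _ _ B M).
  - exact: (@integrableM_supported _ _ _ B M).
  - have -> : e / 2 = B * (e / 2 / B) by rewrite [RHS]mulrC divfK// gt_eqF.
    by rewrite EFinM; apply: lee_wpmul2l => //; rewrite lee_fin ltW.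
have iu : `|\int[mu]_x (u_ j x * D x) - \int[mu]_x (u x * D x)| <= e / 2.
  rewrite -lee_fin; apply: le_trans (dist_RintegralM (A := setT) (B := C) _ _ _ _ _ _ _ _ _) _ => //.
  - exact: L1loc_measurable (L1_L1loc (l1u_ j)).
  - exact: L1loc_measurable (L1_L1loc l1u).
  - exact: ltW.
  - by move=> x; case.
  - by apply: (@L1_integrableM _ _ C) => //; exact: ltW.
  - by apply: (@L1_integrableM _ _ C) => //; exact: ltW.
  - have -> : e / 2 = C * (e / 2 / C) by rewrite [RHS]mulrC divfK// gt_eqF.
    by rewrite EFinM; apply: lee_wpmul2l => //; rewrite lee_fin ltW.
have := weakj _ tphi; rewrite -/D => E; rewrite E in iw.
rewrite (le_trans (ler_distD (\int[mu]_x (u_ j x * D x)) _ _))// (splitr e) lerD//.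
by rewrite distrC.
Qed.

Lemma cvg_L1_truncation u e : L1 u -> 0 < e -> exists N, 0 < N /\
  forall r, N <= r -> (\int[mu]_x `|((u \_ `[- r, r]) x - u x)%R|%:E <= e%:E)%E.
Proof.
move=> l1u e0; have mu_ := L1loc_measurable (L1_L1loc l1u).
pose f_ n := u \_ `[- n%:R, n%:R].
have mr (r : R) : measurable_fun setT (u \_ `[- r, r]).
  by apply/(measurable_restrictT _ _).1 => //; exact: measurable_funTS.
have h1 n : measurable_fun setT (EFin \o f_ n) by apply/measurable_EFinP; exact: mr.
have h2 : measurable_fun setT (EFin \o u) by exact/measurable_EFinP.
have h3 : {ae mu, forall x, setT x -> (EFin \o f_ n) x @[n --> \oo] --> (EFin \o u) x}.
  apply: aeW => x _; apply: cvg_near_cst.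
  have [n _ hn] := @nbhs_infty_ger R `|x|.
  exists n => // m /hn /= xm; rewrite /f_ patchE mem_set//= in_itv/= -ler_norml.
  exact: xm.
have h4 : mu.-integrable setT (EFin \o (fun x => `|u x|)) by exact: integrable_norm.
have h5 : {ae mu, forall x n, setT x ->
    (`|(EFin \o f_ n) x| <= (EFin \o (fun x => `|u x|%R)) x)%E}.
  apply: aeW => x n _; rewrite lee_fin /f_ patchE.
  by case: ifP => // _; rewrite normr0.
have [_ H _] := @dominated_convergence _ _ _ mu setT measurableT (fun n => EFin \o f_ n)
  (EFin \o u) _ h1 h2 h3 h4 h5.
have X0 n : (0 <= [sequence \int[mu]_x `|(EFin \o f_ n) x - (EFin \o u) x|]_n n)%E.
  exact: integral_ge0.
have [n _ hn] := (ge0_cvge0P X0).1 H e e0.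
(* The successor makes the threshold positive; a larger [r] only shrinks the set where the error is
   [|u|]. *)
exists n.+1%:R; split=> // r nr.
apply: le_trans (hn n.+1 (leqnSn _)) => /=.
apply: ge0_le_integral => //=.
- by apply/measurable_EFinP/measurableT_comp => //; apply: measurable_funB => //; exact: mr.
- by apply/measurable_EFinP/measurableT_comp => //; apply: measurable_funB => //; exact: mr.
move=> x _; rewrite lee_fin /f_ !patchE.
case: ifPn => [_|hr]; first by rewrite subrr normr0.
rewrite ifN//; apply: contra hr; rewrite !inE/= !in_itv/= -!ler_norml => h.
exact: le_trans h _.
Qed.

End Approximation.

(** * Approximation by test functions *)

Section Density.
Set Implicit Arguments.
Unset Strict Implicit.
Variables (R : realType) (a : R).
Hypotheses (a0 : 0 < a) (a1 : a < 1).
Notation mu := (@lebesgue_measure R).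
Implicit Types (f g h phi eta u v : R -> R) (x y c B M e t : R) (d : side).

Lemma L1_supported f M : L1loc f -> supported M f -> L1 f.
Proof.
move=> /L1locP[_ /(_ M) lf] sf; rewrite /L1 (_ : f = f \_ `[- M, M]).
  by rewrite -restrict_EFin; apply/(integrable_mkcond _ _).1.
apply/funext => x; rewrite patchE; case: ifPn => //.
by rewrite notin_setE/= in_itv/= -ler_norml => /negP; rewrite -ltNge => /sf.
Qed.

Lemma integrableM_continuous f g M : L1loc f -> supported M f -> continuous g ->
  mu.-integrable setT (EFin \o (fun y => f y * g y)).
Proof.
move=> lf sf cg; have mf := L1loc_measurable lf.
have mg := continuous_measurable_fun cg.
have cK : compact [set g x | x in `[- M, M]].
  by apply: continuous_compact; [exact: continuous_subspaceT|exact: segment_compact].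
have [B [B0 hB]] := compact_sub_itv cK.
have h : mu.-integrable setT (fun x => (B%:E * (f x)%:E)%E).
  by apply: integrableZl => //; exact: L1_supported sf.
apply: le_integrable h => //; first by apply/measurable_EFinP; exact: measurable_funM.
move=> x _ /=; rewrite lee_fin mulrC !normrM.
have [xM|/sf ->] := lerP `|x| M; last by rewrite normr0 !mulr0.
rewrite ler_wpM2r// (ger0_norm (ltW B0)).
have := hB (g x); rewrite /= in_itv/= -ler_norml; apply.
by exists x => //=; rewrite in_itv/= -ler_norml.
Qed.

(** The kernel lacks compact support, so its exchange with [f] through [conv_conv] rests on the
    support of [f]. *)
Lemma frac_derivative_conv d f phi M : L1loc f -> 0 < M -> supported M f ->
  test_function phi ->
  frac_derivative d a (conv f phi) = conv f (frac_derivative d a phi).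
Proof.
move=> lf M0 sf tphi; have tw := test_function_conv lf M0 sf tphi.
have tphi' := test_function_derive1 tphi.
have [N [B [_ _ sN bB]]] := test_function_bounded tphi'.
have lk := L1loc_kernel a1 d.
have mphi' := L1loc_measurable (test_function_L1loc tphi').
have lck : L1loc (conv (kernel a d) phi^`()%classic).
  exact: continuous_L1loc (conv_continuous lk tphi').
apply/funext => x; rewrite (frac_derivativeE a1 d x tw).
have [_ ->] := derive_conv_test lf tphi.
rewrite (conv_conv x lk lf sf mphi' bB sN).
rewrite {1}/conv -RintegralZl//; last first.
  apply: (integrableM_continuous lf sf) => y.
  apply: (@continuous_comp _ _ _ (fun y => x - y)).
    by apply: continuousB => //; exact: cvg_cst.
  exact: conv_continuous.
apply: eq_Rintegral => y _.
by rewrite (frac_derivativeE a1 d (x - y) tphi) mulrCA.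
Qed.

Lemma weak_frac_derivative_mollification d u v phi x :
  is_weak_frac_derivative d a u v -> test_function phi ->
  conv u (frac_derivative d a phi) x = conv v phi x.
Proof.
move=> [_ weak] tphi; rewrite /conv (weak _ (test_function_reflect x tphi)).
by apply: eq_Rintegral => y _; rewrite (frac_derivative_reflect a1 d x y tphi).
Qed.

(** For [|y| > r] and [|x| <= M] one has [|x - y| > r - M]: the removed part of [u] meets only the
    tail of [g]. *)
Lemma conv_truncation_le u g c r M x : L1 u -> measurable_fun setT g ->
  0 <= c -> (forall y, r - M < `|y| -> `|g y| <= c) -> `|x| <= M ->
  (exists B, 0 <= B /\ bounded_by B g) ->
  (`|conv u g x - conv (u \_ `[- r, r]) g x|%:E <= c%:E * \int[mu]_y `|u y|%:E)%E.
Proof.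
move=> l1u mg c0 hg xM [B [B0 bB]].
have mu_ := L1loc_measurable (L1_L1loc l1u).
have mur : measurable_fun setT (u \_ `[- r, r]).
  by apply/(measurable_restrictT _ _).1 => //; exact: measurable_funTS.
have l1ur : L1 (u \_ `[- r, r]).
  apply: le_integrable l1u => //; first exact/measurable_EFinP.
  by move=> y _; rewrite lee_fin patchE; case: ifP => // _; rewrite normr0.
have mgx : measurable_fun setT (fun y => g (x - y)) by exact: measurable_reflect.
have bgx : bounded_by B (fun y => g (x - y)) by move=> y; exact: bB.
rewrite /conv -RintegralB//; last 2 first.
- exact: (L1_integrableM l1u mgx B0 bgx).
- exact: (L1_integrableM l1ur mgx B0 bgx).
apply: le_trans (Rintegral_le_abs _) _.
  by apply: measurable_funB; exact: measurable_funM.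
rewrite -ge0_integralZl//; last by apply/measurable_EFinP/measurableT_comp.
apply: ge0_le_integral => //=.
- by apply/measurable_EFinP/measurableT_comp => //; apply: measurable_funB; exact: measurable_funM.
- by apply: measurable_funeM; apply/measurable_EFinP/measurableT_comp.
move=> y _; rewrite -EFinM lee_fin patchE; case: ifPn => [_|].
  by rewrite subrr normr0 mulr_ge0.
rewrite notin_setE/= in_itv/= -ler_norml => /negP; rewrite -ltNge => hy.
rewrite mul0r subr0 normrM mulrC ler_wpM2r// hg//.
have : `|y : R| <= `|x| + `|x - y|.
  by rewrite -{1}[y](subKr x) (le_trans (ler_normB _ _)).
by have := hy; lra.
Qed.

Lemma weak_frac_derivative_approx d u v M e : L1 u -> is_weak_frac_derivative d a u v ->
  0 < M -> 0 < e -> exists w, [/\ test_function w,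
    (\int[mu]_x `|(w x - u x)%R|%:E <= e%:E)%E &
    (\int[mu]_(x in `[(- M)%R, M]) `|(frac_derivative d a w x - v x)%R|%:E <= e%:E)%E].
Proof.
move=> l1u weak M0 e0; have [lv _] := weak.
have lu := L1_L1loc l1u; have mu_ := L1loc_measurable lu.
have e3 : 0 < e / 3 by rewrite divr_gt0.
have e2 : 0 < e / 2 by rewrite divr_gt0.
have [N [N0 hN]] := cvg_L1_truncation l1u e3.
have mr (r : R) : measurable_fun setT (u \_ `[- r, r]).
  by apply/(measurable_restrictT _ _).1 => //; exact: measurable_funTS.
have lr (r : R) : L1loc (u \_ `[- r, r]).
  apply: L1_L1loc; apply: le_integrable l1u => //; first by apply/measurable_EFinP; exact: mr.
  by move=> y _; rewrite lee_fin patchE; case: ifP => // _; rewrite normr0.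
have sr (r : R) : supported r (u \_ `[- r, r]).
  move=> y hy; rewrite patchE ifN// notin_setE/= in_itv/= -ler_norml.
  by apply/negP; rewrite -ltNge.
have N1 : 0 < N + 1 by rewrite addr_gt0.
have [ea [ea0 ha]] := cvg_mollification (lr N) N1 e3.
have [eb [eb0 hb]] := cvg_mollification lv M0 e2.
(* [ea] serves the truncation at [N], [eb] serves [v], and [1] keeps the mollified truncation inside
   [[-(N + 1), N + 1]]. *)
pose ep := Num.min (Num.min ea eb) 1.
have ep0 : 0 < ep by rewrite !lt_min ea0 eb0 ltr01.
have [eta [teta meta]] := mollifier_exists ep0.
have [[deta ceta'] eta0 seta eta1] := meta.
pose D := frac_derivative d a eta.
have mD : measurable_fun setT D := frac_derivative_measurable a1 d teta.
have [BD [BD0 bD]] := frac_derivative_bounded a0 a1 d teta.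
pose I := (\int[mu]_x `|u x|%:E)%E.
have I0 : (0 <= I)%E by apply: integral_ge0.
have Ifin : I \is a fin_num by rewrite ge0_fin_numE//; have /integrableP[] := l1u.
(* The tail term is at most [c * I] pointwise, hence at most [e / 2] over the length [2 * M]; the
   [+ 1] guards against [I = 0]. *)
pose c := e / 2 / (2 * M) / (fine I + 1).
have fI0 : 0 <= fine I by rewrite fine_ge0.
have c0 : 0 < c by rewrite !divr_gt0 ?mulr_gt0// ltr_wpDl.
have [T [T0 hT]] := frac_derivative_decay a0 a1 d teta c0.
pose r := Num.max N (M + T).
have rN : N <= r by rewrite le_max lexx.
have rT : M + T <= r by rewrite le_max lexx orbT.
have r0 : 0 < r by exact: lt_le_trans rN.
(* [r] is chosen after the scale [ep] of [eta], since [T] depends on [eta]. *)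
exists (conv (u \_ `[- r, r]) eta).
have tw := test_function_conv (lr r) r0 (sr r) teta.
have mw := L1loc_measurable (test_function_L1loc tw).
have metaf := L1loc_measurable (test_function_L1loc teta).
split=> //.
(* [V] is the part of [u] between the radii [N] and [r]; its smallness depends on [N] alone. *)
- pose U := u \_ `[- N, N].
  pose V x := (u \_ `[- r, r]) x - U x.
  have mV : measurable_fun setT V by apply: measurable_funB; exact: mr.
  have lV : L1loc V by exact: (locally_integrableB (lr r) (lr N)).
  have hV : (\int[mu]_x `|V x|%:E <= (e / 3)%:E)%E.
    apply: le_trans (hN N (lexx _)); apply: ge0_le_integral => //=.
    + by apply/measurable_EFinP/measurableT_comp.
    + by apply/measurable_EFinP/measurableT_comp => //; apply: measurable_funB => //; exact: mr.
    move=> x _; rewrite lee_fin /V /U.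
    have [xr|xr] := lerP `|x| r.
      by rewrite [in leRHS]distrC [X in `|X - _|]patchE mem_set//= in_itv/= -ler_norml.
    by rewrite (sr r x xr) (sr N x (le_lt_trans rN xr)) subr0 normr0.
  have tU := test_function_conv (lr N) N0 (sr N) teta.
  have mU := L1loc_measurable (test_function_L1loc tU).
  have cV : measurable_fun setT (conv V eta) by exact: conv_measurable lV teta.
  have h1 : (\int[mu]_x `|conv V eta x|%:E <= (e / 3)%:E)%E.
    exact: le_trans (le_L1_conv mV metaf eta0 eta1 cV) hV.
  have h2 : (\int[mu]_x `|(conv U eta x - U x)%R|%:E <= (e / 3)%:E)%E.
    (* Both terms vanish outside [[-(N + 1), N + 1]], so the local mollification estimate is global
       here. *)
    rewrite (@ge0_integral_supported _ (fun x => conv U eta x - U x) (N + 1)).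
      by apply: (ha ep) => //; rewrite /ep !ge_min lexx.
    move=> x hx.
    have -> : U x = 0 by apply: (sr N); move: hx; lra.
    rewrite (supported_conv (sr N) seta) ?subr0//.
    by apply: le_lt_trans hx; rewrite lerD2l ge_min lexx orbT.
  have h3 := hN N (lexx _); rewrite -/U in h3.
  have E x : conv (u \_ `[- r, r]) eta x = conv V eta x + conv U eta x.
    have [Me [Be [_ _ sMe bBe]]] := test_function_bounded teta.
    have ie (k : R -> R) : L1loc k -> mu.-integrable setT (EFin \o (fun y => k y * eta (x - y))).
      move=> lk; apply: (@integrableM_supported _ _ _ Be (`|x| + Me)) => //.
        exact: measurable_reflect.
      exact: supported_reflect.
    rewrite /conv -RintegralD//; [|exact: ie|exact: ie (lr N)].
    by apply: eq_Rintegral => y _; rewrite -mulrDl /V subrK.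
  have mUu : measurable_fun setT (fun x => U x - u x) by apply: measurable_funB => //; exact: mr.
  have mUU : measurable_fun setT (fun x => conv U eta x - U x) by apply: measurable_funB => //; exact: mr.
  have mE (g : R -> R) : measurable_fun setT g -> measurable_fun setT (fun x => `|g x|%:E).
    by move=> mg; apply/measurable_EFinP/measurableT_comp.
  apply: (@le_trans _ _ (\int[mu]_x (`|conv V eta x|%:E +
     (`|(conv U eta x - U x)%R|%:E + `|(U x - u x)%R|%:E)))%E).
    apply: ge0_le_integral => //=.
    + by apply: mE; exact: measurable_funB.
    + by apply: emeasurable_funD; [exact: mE|apply: emeasurable_funD; exact: mE].
    move=> x _; rewrite -!EFinD lee_fin E.
    have -> : conv V eta x + conv U eta x - u x =
       conv V eta x + ((conv U eta x - U x) + (U x - u x)) by ring.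
    by rewrite (le_trans (ler_normD _ _))// lerD2l ler_normD.
  rewrite ge0_integralD//=; last 3 first.
  + exact: mE.
  + by move=> x _; rewrite -EFinD lee_fin addr_ge0.
  + by apply: emeasurable_funD; exact: mE.
  rewrite ge0_integralD//=; last 2 first.
  + exact: mE.
  + exact: mE.
  apply: le_trans (leeD h1 (leeD h2 h3)) _.
  by rewrite -!EFinD lee_fin; lra.
- rewrite (frac_derivative_conv d (lr r) r0 (sr r) teta) -/D.
  have key x : `|x| <= M ->
     (`|(conv (u \_ `[- r, r]) D x - v x)%R|%:E <=
      `|(conv v eta x - v x)%R|%:E + c%:E * I)%E.
    move=> xM.
    have hD y : r - M < `|y| -> `|D y| <= c.
      by move=> hy; apply: hT; apply: le_lt_trans hy; lra.
    have h := conv_truncation_le l1u mD (ltW c0) hD xM (ex_intro _ BD (conj (ltW BD0) bD)).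
    rewrite (weak_frac_derivative_mollification x weak teta) in h.
    rewrite -/I in h.
    apply: le_trans (leeD (lexx _) h); rewrite -EFinD lee_fin.
    have := ler_distD (conv v eta x) (conv (u \_ `[- r, r]) D x) (v x).
    by rewrite (distrC (conv _ D x) (conv v eta x)) [X in _ <= X -> _]addrC.
  have hb' := hb ep eta _ meta.
  have {}hb' : (\int[mu]_(x in `[(- M)%R, M]) `|(conv v eta x - v x)%R|%:E <= (e / 2)%:E)%E.
    by apply: hb'; rewrite /ep !ge_min lexx orbT.
  have mI (g : R -> R) : measurable_fun setT g ->
      measurable_fun (`[- M, M] : set R) (fun x => `|g x|%:E).
    by move=> mg; apply/measurable_EFinP/measurableT_comp => //; exact: measurable_funTS.
  have mv := L1loc_measurable lv.
  have mcv := conv_measurable lv teta.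
  have mcD : measurable_fun setT (conv (u \_ `[- r, r]) D).
    rewrite /D -(frac_derivative_conv d (lr r) r0 (sr r) teta).
    exact: frac_derivative_measurable.
  apply: (@le_trans _ _ (\int[mu]_(x in `[(- M)%R, M])
      (`|(conv v eta x - v x)%R|%:E + c%:E * I))%E).
    apply: ge0_le_integral => //=.
    + by apply: mI; exact: measurable_funB.
    + apply: emeasurable_funD; last exact: measurable_cst.
      by apply: mI; exact: measurable_funB.
    by move=> x; rewrite in_itv/= -ler_norml; exact: key.
  have cI0 : (0 <= c%:E * I)%E by rewrite mule_ge0// lee_fin ltW.
  rewrite ge0_integralD//=; last first.
  + by apply: mI; exact: measurable_funB.
  rewrite integral_cst//= lebesgue_measure_itv/= lte_fin ifT; last by lra.
  apply: le_trans (leeD hb' (lexx _)) _.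
  rewrite -EFinB -(fineK Ifin) -!EFinM -EFinD lee_fin /c.
  have -> : e / 2 / (2 * M) / (fine I + 1) * fine I * (M - - M) =
      e / 2 * (fine I / (fine I + 1)).
    have n1 : fine I + 1 != 0 by rewrite gt_eqF// ltr_wpDl.
    have n2 : M != 0 by rewrite gt_eqF.
    by field; rewrite n1 n2.
  have : fine I / (fine I + 1) <= 1.
    by rewrite ler_pdivrMr ?ltr_wpDl// mul1r lerDl ler01.
  by move/(ler_wpM2l (ltW e2)); lra.
Qed.

Lemma weak_frac_derivative_dense d u v : L1 u -> is_weak_frac_derivative d a u v ->
  exists u_ : nat -> R -> R,
    [/\ forall j, test_function (u_ j), cvg_L1 u_ u
      & exists w_ : nat -> R -> R,
          (forall j, is_weak_frac_derivative d a (u_ j) (w_ j)) /\ cvg_L1loc w_ v].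
Proof.
move=> l1u weak; have [lv _] := weak.
(* Interval and error are both tied to [j]: every compact set ends up inside [[-(j + 1), j + 1]], so
   one sequence serves them all. *)
have ex (j : nat) : exists w, [/\ test_function w,
    (\int[mu]_x `|(w x - u x)%R|%:E <= (j.+1%:R^-1)%:E)%E &
    (\int[mu]_(x in `[(- j.+1%:R)%R, j.+1%:R])
       `|(frac_derivative d a w x - v x)%R|%:E <= (j.+1%:R^-1)%:E)%E].
  apply: (weak_frac_derivative_approx l1u weak); first by rewrite ltr0n.
  by rewrite invr_gt0 ltr0n.
have [w_ Hw] := choice ex.
have inv_le (e : R) : 0 < e -> \forall n \near \oo, (n.+1%:R^-1 : R) <= e.
  by move=> e0; apply: filterS (near_infty_natSinv_lt (PosNum e0)) => n /ltW.
exists w_; split.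
- by move=> j; have [] := Hw j.
- apply/ge0_cvge0P; first by move=> n; exact: integral_ge0.
  move=> e e0; apply: filterS (inv_le e e0) => n ne.
  by have [_ h _] := Hw n; apply: (le_trans h); rewrite lee_fin.
exists (fun j => frac_derivative d a (w_ j)); split.
  by move=> j; apply: (is_weak_frac_derivative_test a1); have [] := Hw j.
move=> K cK; have [M [M0 KM]] := compact_sub_itv cK.
apply/ge0_cvge0P; first by move=> n; exact: integral_ge0.
move=> e e0.
have nM : \forall n \near \oo, M <= n.+1%:R.
  have [n _ hn] := @nbhs_infty_ger R M.
  by exists n => // m /hn /le_trans; apply; rewrite ler_nat.
apply: filterS2 (inv_le e e0) nM => n ne Mn.
have [tw _ h] := Hw n.
apply: le_trans (le_trans h _); last by rewrite lee_fin.
have mD := frac_derivative_measurable a1 d tw.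
have mv := L1loc_measurable lv.
apply: ge0_subset_integral => //=.
- exact: compact_measurable.
- by apply/measurable_EFinP/measurableT_comp => //; apply: measurable_funTS; exact: measurable_funB.
- move=> x /KM /=; rewrite !in_itv/= -!ler_norml => /le_trans; exact.
Qed.

End Density.

Theorem theorem4p2 (R : realType) (a : R) (ha0 : 0 < a) (ha1 : a < 1)
    (u v : R -> R) (hu : L1 u) (hv : L1loc v) (d : side) :
  is_weak_frac_derivative d a u v <->
  exists u_ : nat -> R -> R,
    [/\ forall j, test_function (u_ j),
        cvg_L1 u_ u
      & exists w_ : nat -> R -> R,
          (forall j, is_weak_frac_derivative d a (u_ j) (w_ j)) /\
          cvg_L1loc w_ v].
Proof.
split=> [|[u_ [tu cu [w_ [weak cw]]]]]; first exact: weak_frac_derivative_dense.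
apply: (is_weak_frac_derivative_closed ha0 ha1 hu hv _ weak cu cw) => j.
have [M [_ [_ _ sM _]]] := test_function_bounded (tu j).
exact: L1_supported (test_function_L1loc (tu j)) sM.
Qed.
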